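(* Consider the nonstationary heavy-tailed multi-armed bandit problem with $K$ arms, horizon $T$ and variation budget $V_T>0$, where every reward satisfies $\mathbb{E}[(X_t^k)^2]\le1$. Let $\tau=\lceil K^{1/3}(T/V_T)^{2/3}\rceil$, let $a>1$ and $\zeta>0$ satisfy $\psi(2\zeta/a)\ge 2a/\zeta$, where $\psi(x)=(1+1/x)\ln(1+x)-1$, and let R-RMOSS be the policy that partitions $\{1,\dots,T\}$ into consecutive epochs of length $\tau$ (the last possibly shorter) and on each epoch discards all past observations and runs Robust MOSS afresh with horizon parameter $\tau$. Then \[\sup_{\mathcal{F}_T^{\mathcal{K}}\in\mathcal{E}(V_T,T,K)} R_T^{\text{R-RMOSS}}\in\mathcal{O}\big((KV_T)^{1/3}T^{2/3}\big).\]
   Context: Arms $\mathcal{K}=\{1,\dots,K\}$, times $\mathcal{T}=\{1,\dots,T\}$. For each arm $k$ and time $t$, reward $X_t^k$ is drawn from a distribution $f_t^k$ (all $X_t^k$ independent), with mean $\mu_t^k$. The environment is the collection of these distribution sequences; its total variation is $\sum_{t=1}^{T-1}\sup_k|\mu_{t+1}^k-\mu_t^k|$, and $\mathcal{E}(V_T,T,K)$ is the set of environments (satisfying $\mathbb{E}[(X_t^k)^2]\le 1$ for all $k,t$) with total variation at most $V_T$. A policy chooses $\varphi_t$ based on past observations $\{(\varphi_s,X_s^{\varphi_s})\}_{s<t}$; the regret is $R_T=\mathbb{E}[\sum_{t=1}^T(\max_k\mu_t^k-\mu_t^{\varphi_t})]$. Robust MOSS with horizon parameter $H$: let $\ln_+(x)=\max(\ln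 x,1)$, $h(m)=a^{\lfloor\log_a m\rfloor+1}$, $B_m=\sqrt{h(m)/\ln_+(H/(Kh(m)))}$, $c_m=\sqrt{\ln_+(H/(Km))/m}$, $\mathrm{sat}(x,B)=\mathrm{sign}(x)\min(|x|,B)$. It first selects each arm once; afterwards at time $t$, with $n_k(t)$ the number of past selections of arm $k$ (since the last restart) and $\bar\mu^k_{n_k(t)}=\frac{1}{n_k(t)}\sum_{s}\mathbf{1}\{\varphi_s=k\}\mathrm{sat}(X_s^{\varphi_s},B_{n_k(t)})$ (sum over those past times), it selects $\arg\max_k\bar\mu^k_{n_k(t)}+(1+\zeta)c_{n_k(t)}$.
   Formalization: The bound is stated with a constant depending only on a and ζ, and only when τ ≤ T (i.e. V_T ≥ √(K/T)); without this it fails: for K=T=2 and constant rewards 1 and 0, regret is 1 for small V_T while the bound tends to 0 as V_T→0. *)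

(* Defs.v *)
From HB Require Import structures.
From mathcomp Require Import all_boot all_order all_algebra.
From mathcomp Require Import all_classical all_reals all_analysis.
Set Implicit Arguments. Unset Strict Implicit. Unset Printing Implicit Defensive.
Import Order.TTheory GRing.Theory Num.Theory.
Local Open Scope classical_set_scope.
Local Open Scope ring_scope.

Section Bandit.
Variable R : realType.

(* Environments.  Times are indexed from 0 (time t of the paper is     *)
(* index t-1 here); arms are 'I_K.  f t k is the law of X_t^k, a      *)
(* probability measure on the Borel sets of R.                        *)

Definition mean_of (K : nat) (f : nat -> 'I_K -> probability R R) (t : nat)
  (k : 'I_K) : R := fine (\int[f t k]_x (x%:E))%E.

Definition second_moment_le1 (K T : nat) (f : nat -> 'I_K -> probability R R) :=
  forall (t : nat) (k : 'I_K), (t < T)%N -> (\int[f t k]_x ((x ^+ 2)%:E) <= 1)%E.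

Definition total_variation (K T : nat) (f : nat -> 'I_K -> probability R R) : R :=
  \sum_(t < T.-1) \big[Num.max/0]_(k : 'I_K)
     `|mean_of f t.+1 k - mean_of f t k|.

Definition env_class (K T : nat) (V : R) (f : nat -> 'I_K -> probability R R) :=
  second_moment_le1 T f /\ total_variation T f <= V.

Definition mutually_independent {d} {Omega : measurableType d}
  (P : probability Omega R) (I : finType) (Y : I -> Omega -> R) : Prop :=
  (forall i, measurable_fun setT (Y i)) /\
  forall (S : {set I}) (B : I -> set R), (forall i, measurable (B i)) ->
    P (\bigcap_(i in [set i | i \in S]) (Y i @^-1` B i)) =
    (\big[*%E/1%E]_(i in S) P (Y i @^-1` B i))%E.

(* Policies: a (deterministic) policy maps the full past history       *)
(* [:: (phi_1, X_1^{phi_1}); ...; (phi_{t-1}, X_{t-1}^{phi_{t-1}})]    *)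
(* to the arm played at time t.                                        *)
Definition policy (K : nat) := seq ('I_K * R) -> 'I_K.

Fixpoint history {K : nat} {Omega : Type} (pi : policy K)
  (X : nat -> 'I_K -> Omega -> R) (omega : Omega) (t : nat) : seq ('I_K * R) :=
  match t with
  | 0 => [::]
  | t'.+1 => let h := history pi X omega t' in
             rcons h (pi h, X t' (pi h) omega)
  end.

Definition gap (K : nat) (f : nat -> 'I_K -> probability R R) (t : nat) (k : 'I_K) : R :=
  \big[Num.max/mean_of f t k]_(j : 'I_K) mean_of f t j - mean_of f t k.

Definition regret {d} {Omega : measurableType d} (P : probability Omega R)
  (K : nat) (f : nat -> 'I_K -> probability R R) (X : nat -> 'I_K -> Omega -> R)
  (pi : policy K) (T : nat) : \bar R :=
  (\int[P]_omega ((\sum_(t < T) gap f t (pi (history pi X omega t)))%:E))%E.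

Definition lnp (x : R) : R := Num.max (ln x) 1.

Definition psi (x : R) : R := (1 + x^-1) * ln (1 + x) - 1.

Definition hfun (a : R) (m : nat) : R :=
  a `^ ((Num.floor (ln (m%:R : R) / ln a))%:~R + 1).

Definition Bm (K : nat) (a : R) (H m : nat) : R :=
  Num.sqrt (hfun a m / lnp (H%:R / (K%:R * hfun a m))).

Definition cm (K : nat) (H m : nat) : R :=
  Num.sqrt (lnp (H%:R / (K%:R * m%:R)) / m%:R).

Definition sat (x B : R) : R := Num.sg x * Num.min `|x| B.

Definition npulls (K : nat) (hl : seq ('I_K * R)) (k : 'I_K) : nat :=
  count (fun p => p.1 == k) hl.

Definition trunc_mean (K : nat) (a : R) (H : nat) (hl : seq ('I_K * R))
  (k : 'I_K) : R :=
  (\sum_(p <- hl | p.1 == k) sat p.2 (Bm K a H (npulls hl k)))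
    / (npulls hl k)%:R.

Definition rmoss_index (K : nat) (a zeta : R) (H : nat) (hl : seq ('I_K * R))
  (k : 'I_K) : R :=
  trunc_mean a H hl k + (1 + zeta) * cm K H (npulls hl k).

(* Robust MOSS with horizon parameter H, applied to the observations
   since the last restart hl: first select each arm once, then the
   arm with the largest index (ties broken by [arg max]). k0 : 'I_K only
   witnesses that K > 0. *)
Definition robust_moss (K : nat) (k0 : 'I_K) (a zeta : R) (H : nat)
  (hl : seq ('I_K * R)) : 'I_K :=
  if [pick k | npulls hl k == 0%N] is Some k then k
  else Order.arg_max k0 xpredT (rmoss_index a zeta H hl).

Definition rrmoss (K : nat) (k0 : 'I_K) (a zeta : R) (tau : nat) : policy K :=
  fun h => robust_moss k0 a zeta tau (drop ((size h %/ tau) * tau) h).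

Definition epoch_length (K T : nat) (V : R) : nat :=
  `| Num.ceil ((K%:R) `^ (1/3) * (T%:R / V) `^ (2/3)) |%N.

End Bandit.

(* Main.v *)
Require Import Defs.
From HB Require Import structures.
From mathcomp Require Import all_boot all_order all_algebra.
From mathcomp Require Import all_classical all_reals all_analysis.
From mathcomp Require Import measurable_realfun ring lra zify.
Set Implicit Arguments. Unset Strict Implicit. Unset Printing Implicit Defensive.
Import Order.TTheory GRing.Theory Num.Theory.
Local Open Scope classical_set_scope.
Local Open Scope ring_scope.

(* On one epoch, with H = tau and eps = sqrt (K / H), compare with the arm k* that is
   best at the start of the epoch; the drift of the means costs O(H V_epoch).  When
   all arms have been pulled, the index of the selected arm k beats that of k*, so
   its gap is at most the sum of
   - the largest underestimation of k* beyond zeta c_n over all times, and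
   - (2 + zeta) c_n plus the centered truncated mean of k, with n the number of
     pulls of k.
   Both noise terms are controlled by one maximal inequality for an exponential
   supermartingale s_u: if U_u is the running maximum, then
   U_u + exp (lam (s_u - U_u)) / lam is again a supermartingale, whence
   E (sup s - y)_+ <= exp (- lam y) / lam.
   For k* it is applied once per truncation level h = a ^ j, where the condition on
   psi and Bennett's inequality give O(eps min(q, 1/q)) with q = eps sqrt h, which is
   summable over j.  For the selected arm it is applied once per pair (k, n): such a
   pair occurs at most once, and the excess over eps is summable over n with total
   O(1 / eps).  The regret of an epoch is thus O(sqrt (K H) + H V_epoch), and the
   choice of tau balances the sum over the T / tau epochs. *)

(** * Independence of a fresh variable from a family of past ones *)

Section Independence.
Context {R : realType} {d : measure_display} {Omega : measurableType d}.
Variable P : probability Omega R.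
Context {I : finType}.
Variable Y : I -> Omega -> R.

(** A pi-system: the sigma-algebra it generates is the information carried by the [Y i] with [i] in
    [J]. *)
Definition cylinders (J : {set I}) : set (set Omega) :=
  [set A | exists2 B : I -> set R, (forall i, measurable (B i)) &
     A = \bigcap_(i in [set i | i \in J]) (Y i @^-1` B i)].

Lemma cylinders_setI J : setI_closed (cylinders J).
Proof.
move=> _ _ [B mB ->] [C mC ->].
exists (fun i => B i `&` C i); first by move=> i; apply: measurableI.
apply/seteqP; split=> w.
  by move=> [Bw Cw] i iJ; split; [exact: Bw|exact: Cw].
by move=> BCw; split=> i iJ; have [] := BCw i iJ.
Qed.

Lemma cylindersT J : cylinders J setT.
Proof.
exists (fun=> setT) => //.
by apply/seteqP; split=> w.
Qed.

Hypothesis indep : mutually_independent P Y.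

Let mY i : measurable_fun setT (Y i).
Proof. exact: indep.1. Qed.

Lemma cylinders_measurable J : cylinders J `<=` measurable.
Proof.
move=> _ [B mB ->]; apply: fin_bigcap_measurable => [|i _]; first exact: finite_finset.
by rewrite -[X in measurable X]setTI; exact: mY.
Qed.

Lemma sigma_cylinders_measurable (J : {set I}) (A : set Omega) :
  measurable (A : set (g_sigma_algebraType (cylinders J))) -> measurable A.
Proof.
apply: smallest_sub; last exact: cylinders_measurable.
exact: sigma_algebra_measurable.
Qed.

Lemma measurable_fun_forget (J : {set I}) {d' : measure_display} {T' : measurableType d'}
  (g : Omega -> T') :
  measurable_fun setT (g : g_sigma_algebraType (cylinders J) -> T') ->
  measurable_fun setT g.
Proof.
move=> mg _ B mB; apply: (@sigma_cylinders_measurable J).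
by apply: mg.
Qed.

Lemma measurable_fun_cylinder (J : {set I}) (i : I) : i \in J ->
  measurable_fun setT (Y i : g_sigma_algebraType (cylinders J) -> R).
Proof.
move=> iJ _ B mB; rewrite setTI; apply: sub_sigma_algebra.
exists (fun j => if j == i then B else setT).
  by move=> j; case: ifP.
apply/seteqP; split=> w /=.
  by move=> Bw j jJ /=; case: eqP => // ->.
by move=> /(_ i iJ) /=; rewrite eqxx.
Qed.

Lemma measurable_fun_mono (J J' : {set I}) {d' : measure_display} {T' : measurableType d'}
  (g : Omega -> T') : J \subset J' ->
  measurable_fun setT (g : g_sigma_algebraType (cylinders J) -> T') ->
  measurable_fun setT (g : g_sigma_algebraType (cylinders J') -> T').
Proof.
move=> JJ' mg _ B mB.
have := mg measurableT _ mB.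
apply: smallest_sub; first exact: sigma_algebra_measurable.
move=> _ [C mC ->]; apply: sub_sigma_algebra.
exists (fun i => if i \in J then C i else setT).
  by move=> i; case: ifP.
apply/seteqP; split=> w /=.
  by move=> Cw i iJ' /=; case: ifPn => // iJ; exact: Cw.
move=> Cw i iJ; have /= := Cw i (fintype.subsetP JJ' _ iJ).
by rewrite (iJ : i \in J).
Qed.

Section Past.
Variables (J : {set I}) (i0 : I).
Hypothesis i0J : i0 \notin J.

(** Since [i0] is outside [J], its coordinate is free: the intersection is again a single cylinder,
    over [i0 |: J]. *)
Lemma cylinder_indep (A : set Omega) (B : set R) :
  cylinders J A -> measurable B ->
  P (A `&` Y i0 @^-1` B) = (P A * P (Y i0 @^-1` B))%E.
Proof.
move=> [C mC ->] mB.
pose D i := if i == i0 then B else C i.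
have mD i : measurable (D i) by rewrite /D; case: ifP.
have -> : \bigcap_(i in [set i | i \in J]) (Y i @^-1` C i) `&` Y i0 @^-1` B =
    \bigcap_(i in [set i | i \in i0 |: J]) (Y i @^-1` D i).
  apply/seteqP; split=> w /=.
    move=> [Cw Bw] i /=; rewrite !inE /D; case: eqP => [->//|_ /= iJ].
    exact: Cw.
  move=> Dw; split.
    move=> i iJ; have := Dw i; rewrite /= !inE (iJ : i \in J) orbT => /(_ isT).
    rewrite /D; case: eqP => // ii0.
    by move: i0J; rewrite -ii0 (iJ : i \in J).
  by have := Dw i0; rewrite /= !inE eqxx => /(_ isT); rewrite /D eqxx.
rewrite (indep.2 _ _ mD) big_setU1 //= {1}/D eqxx muleC; congr (_ * _)%E.
rewrite (indep.2 _ _ mC); apply: eq_bigr => i iJ.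
by rewrite /D; case: eqP => // ii0; move: i0J; rewrite -ii0 iJ.
Qed.

Let TJ := g_sigma_algebraType (cylinders J).
(** The identity into the coarser sigma-algebra: it turns the whole past into one random element. *)
Let idJ : Omega -> TJ := id.
Let midJ : measurable_fun setT idJ.
Proof. by move=> _ A mA; rewrite setTI; exact: sigma_cylinders_measurable mA. Qed.

(** Both sides are finite measures in [A] that agree on the pi-system of cylinders, hence on the
    sigma-algebra it generates. *)
Lemma past_indep (A : set TJ) (B : set R) : measurable A -> measurable B ->
  P (A `&` Y i0 @^-1` B) = (P A * P (Y i0 @^-1` B))%E.
Proof.
move=> mA mB.
have mYB : measurable (Y i0 @^-1` B) by rewrite -[X in measurable X]setTI; exact: mY.
pose idm : {mfun Omega >-> TJ} :=
  HB.pack idJ (@isMeasurableFun.Build _ _ _ _ idJ midJ).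
pose m1' : {measure set TJ -> \bar R} := pushforward (mrestr P mYB) idJ.
pose m1 := m1' midJ.
have p0 : 0 <= fine (P (Y i0 @^-1` B)) by apply: fine_ge0.
pose m2 : {measure set TJ -> \bar R} :=
  mscale (NngNum p0) (distribution P idm).
have m12 : m1 A = m2 A.
  apply: (@measure_unique _ R TJ (cylinders J) (fun=> setT)) => //.
  - exact: cylinders_setI.
  - by move=> _; exact: cylindersT.
  - by apply/seteqP; split=> // x _; exists 0%N.
  - move=> C cC; rewrite /m1 /m1' /m2 /= /mscale /= /distribution /pushforward /= /mrestr.
    rewrite fineK ?fin_num_measure// muleC.
    exact: cylinder_indep.
  - move=> _; rewrite /m1 /m1' /pushforward /= /mrestr.
    by apply: (le_lt_trans (probability_le1 P _)); rewrite ?ltry// preimage_setT setTI.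
move: m12; rewrite /m1 /m1' /m2 /= /mscale /= /distribution /pushforward /= /mrestr.
by rewrite fineK ?fin_num_measure// muleC.
Qed.

(** By [past_indep] the joint law of the past and [Y i0] is the product of their laws, and Tonelli's
    theorem separates the factors. *)
Lemma integral_past_indep (g : Omega -> R) (w : R -> R) :
  measurable_fun setT (g : TJ -> R) -> (forall x, 0 <= g x) ->
  measurable_fun setT w -> (forall x, 0 <= w x) ->
  (\int[P]_x (g x * w (Y i0 x))%:E =
   \int[P]_x (g x)%:E * \int[P]_x (w (Y i0 x))%:E)%E.
Proof.
move=> mg g0 mw w0.
pose idm : {mfun Omega >-> TJ} :=
  HB.pack idJ (@isMeasurableFun.Build _ _ _ _ idJ midJ).
pose Ym : {mfun Omega >-> R} :=
  HB.pack (Y i0) (@isMeasurableFun.Build _ _ _ _ (Y i0) (mY i0)).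
pose P1 : probability TJ R := distribution P idm.
pose P2 : probability R R := distribution P Ym.
pose pr : Omega -> (TJ * R)%type := fun x => (idJ x, Y i0 x).
have mpr : measurable_fun setT pr by apply: measurable_fun_pair.
pose prm : {mfun Omega >-> (TJ * R)%type} :=
  HB.pack pr (@isMeasurableFun.Build _ _ _ _ pr mpr).
pose m' : probability (TJ * R)%type R := distribution P prm.
have prodE : forall A : set (TJ * R)%type, measurable A -> (P1 \x P2)%E A = m' A.
  apply: product_measure_unique => A B mA mB.
  rewrite /m' /= /pushforward /= -past_indep//.
pose F (z : (TJ * R)%type) : \bar R := (g z.1 * w z.2)%:E.
have mF : measurable_fun [set: (TJ * R)%type] F.
  apply/measurable_EFinP; apply: measurable_funM.
    exact: (measurableT_comp mg measurable_fst).
  exact: (measurableT_comp mw measurable_snd).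
have F0 z : (0 <= F z)%E by rewrite lee_fin mulr_ge0.
transitivity (\int[m']_z F z)%E.
  rewrite ge0_integral_pushforward//.
transitivity (\int[(P1 \x P2)%E]_z F z)%E.
  by apply: eq_measure_integral => A mA _; exact: esym (prodE _ mA).
have mgE : measurable_fun [set: TJ] (fun x => (g x)%:E) by apply/measurable_EFinP.
have mwE : measurable_fun [set: R] (fun x => (w x)%:E) by apply/measurable_EFinP.
rewrite fubini_tonelli1// /fubini_F /=.
transitivity (\int[P1]_x (((g x)%:E) * \int[P2]_y (w y)%:E))%E.
  apply: eq_integral => x _.
  under eq_integral do rewrite /F /= EFinM.
  by rewrite ge0_integralZl// => [y _|]; rewrite lee_fin.
rewrite ge0_integralZr//; last 2 first.
- by move=> x _; rewrite lee_fin.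
- by apply: integral_ge0 => x _; rewrite lee_fin.
congr (_ * _)%E; rewrite ge0_integral_pushforward// => x _; rewrite lee_fin//.
Qed.
End Past.
End Independence.

(** * A maximal inequality for sums sampled along an adapted choice of arms *)

Section AdaptedSampling.
Context {R : realType} {d : measure_display} {Omega : measurableType d}.
Variable P : probability Omega R.
Variables (K T : nat) (X : nat -> 'I_K -> Omega -> R).

Definition sample (i : 'I_T * 'I_K) : Omega -> R := X i.1 i.2.

(** All rewards before [t], also those of arms that were not played: a filtration larger than the
    player's, which does not depend on the policy. *)
Definition past (t : nat) : {set 'I_T * 'I_K} := [set i : 'I_T * 'I_K | (i.1 < t)%N].

Definition past_type (t : nat) := g_sigma_algebraType (cylinders sample (past t)).

Definition past_measurable (t : nat) {d' : measure_display}
    {T' : measurableType d'} (g : Omega -> T') : Prop :=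
  measurable_fun setT (g : past_type t -> T').

Lemma past_measurable_mono (s t : nat) {d' : measure_display}
    {T' : measurableType d'} (g : Omega -> T') :
  (s <= t)%N -> past_measurable s g -> past_measurable t g.
Proof.
move=> st; apply: measurable_fun_mono.
by apply/fintype.subsetP => i; rewrite !inE => /leq_trans; apply.
Qed.

Lemma past_measurable_reward (t : nat) (k : 'I_K) : (t < T)%N ->
  past_measurable t.+1 (X t k).
Proof.
move=> tT.
by apply: (@measurable_fun_cylinder _ _ _ _ sample _ (Ordinal tT, k)); rewrite inE.
Qed.

Hypothesis indep : mutually_independent P sample.

Lemma past_measurableW (t : nat) {d' : measure_display}
    {T' : measurableType d'} (g : Omega -> T') :
  past_measurable t g -> measurable_fun setT g.
Proof. by move=> mg; apply: (measurable_fun_forget indep) mg. Qed.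

Variable phi : nat -> Omega -> 'I_K.

Definition adapted := forall (t : nat) (k : 'I_K), (t < T)%N ->
  past_measurable t (fun w => phi t w == k).

Hypothesis phi_adapted : adapted.

Lemma past_measurable_selected (t : nat) (k : 'I_K) : (t < T)%N ->
  past_measurable t (fun w => (phi t w == k)%:R : R).
Proof.
move=> tT.
have -> : (fun w => (phi t w == k)%:R : R) =
   (fun w => if phi t w == k then 1 else 0) by apply/funext => w; case: eqP.
by apply: measurable_fun_ifT => //; exact: phi_adapted.
Qed.

Variables (k : 'I_K) (s0 : nat) (z : nat -> R -> R).
Hypothesis mz : forall s, measurable_fun setT (z s).

Definition sampled_sum (u : nat) (w : Omega) : R :=
  \sum_(i < u) (phi (s0 + i) w == k)%:R * z (s0 + i)%N (X (s0 + i)%N k w).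

(** Starting the maximum at [y] makes [running_max y u w - y] the positive part of the excess of the
    sums over [y]. *)
Fixpoint running_max (y : R) (u : nat) (w : Omega) : R :=
  if u is u'.+1 then Num.max (running_max y u' w) (sampled_sum u w) else y.

Lemma running_max_ge (y : R) (u n : nat) (w : Omega) : (0 < u <= n)%N ->
  sampled_sum u w <= running_max y n w.
Proof.
elim: n => [|n IHn]; first by case: u.
move=> /andP[u0]; rewrite leq_eqVlt => /predU1P[->|un]; rewrite /= le_max.
  by rewrite lexx orbT.
by rewrite IHn// u0 -ltnS.
Qed.

Lemma running_max_ge_start (y : R) (n : nat) (w : Omega) : y <= running_max y n w.
Proof. by elim: n => //= n IHn; rewrite le_max IHn. Qed.

Lemma sampled_sumS u w : sampled_sum u.+1 w = sampled_sum u w +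
  (phi (s0 + u) w == k)%:R * z (s0 + u)%N (X (s0 + u)%N k w).
Proof. by rewrite /sampled_sum big_ord_recr. Qed.

Lemma past_measurable_sampled_sum u : (s0 + u <= T)%N ->
  past_measurable (s0 + u) (sampled_sum u).
Proof.
elim: u => [|u IHu] uT.
  rewrite (_ : sampled_sum 0 = fun=> 0); last first.
    by apply/funext => w; rewrite /sampled_sum big_ord0.
  exact: measurable_cst.
rewrite (_ : sampled_sum u.+1 = fun w => sampled_sum u w +
  (phi (s0 + u) w == k)%:R * z (s0 + u)%N (X (s0 + u)%N k w)); last first.
  by apply/funext => w; rewrite sampled_sumS.
rewrite addnS in uT *.
apply: measurable_funD.
  by apply: (past_measurable_mono (leqnSn _)); apply: IHu; exact: ltnW.
apply: measurable_funM.
  by apply: (past_measurable_mono (leqnSn _)); exact: past_measurable_selected.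
by apply: (measurableT_comp (mz _)); exact: past_measurable_reward.
Qed.

Lemma past_measurable_running_max y u : (s0 + u <= T)%N ->
  past_measurable (s0 + u) (running_max y u).
Proof.
elim: u => [|u IHu] uT; first exact: measurable_cst.
apply: measurable_maxr; last exact: past_measurable_sampled_sum.
apply: (@past_measurable_mono (s0 + u)); first by rewrite leq_add2l.
by apply: IHu; move: uT; rewrite addnS; exact: ltnW.
Qed.

(** If [s] is below [y] the two sides coincide; otherwise the left one is [s + lam^-1], and
    [1 + x <= expR x] at [x = lam * (s - y)] concludes. *)
Lemma max_expR_step (lam y s : R) : 0 < lam ->
  Num.max y s + lam^-1 * expR (lam * (s - Num.max y s)) <=
  y + lam^-1 * expR (lam * (s - y)).
Proof.
move=> lam0; case: (leP y s) => [ys|//].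
have : 1 + (lam * s - lam * y) <= expR (lam * (s - y)).
  by rewrite -mulrBr expR_ge1Dx.
move: (expR (lam * _)) => e le_e.
rewrite subrr mulr0 expR0 mulr1 -(ler_pM2l lam0) !mulrDr mulrA.
by rewrite mulfV ?gt_eqF// mul1r; lra.
Qed.

Variable lam : R.
Hypothesis lam0 : 0 < lam.
Hypothesis mgf_le1 : forall s, (s0 <= s < T)%N ->
  (\int[P]_w (expR (lam * z s (X s k w)))%:E <= 1)%E.

(* [lam^-1 * expR (lam * (s - m))], with [m] the running maximum, is what the
   maximum is still expected to gain; it makes the sum a supermartingale. *)
Let potential y u w := running_max y u w - y +
  lam^-1 * expR (lam * (sampled_sum u w - running_max y u w)).

Let potential_ge0 y u w : 0 <= potential y u w.
Proof.
rewrite addr_ge0// ?subr_ge0 ?running_max_ge_start//.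
by rewrite mulr_ge0 ?expR_ge0// invr_ge0 ltW.
Qed.

Let potential_step y u : (s0 + u < T)%N ->
  (\int[P]_w (potential y u.+1 w)%:E <= \int[P]_w (potential y u w)%:E)%E.
Proof.
move=> uT.
pose M w := running_max y u w - y.
pose A w := lam^-1 * expR (lam * (sampled_sum u w - running_max y u w)).
pose b w : R := (phi (s0 + u) w == k)%:R.
pose W x := expR (lam * z (s0 + u)%N x).
have M0 w : 0 <= M w by rewrite subr_ge0 running_max_ge_start.
have A0 w : 0 <= A w by rewrite mulr_ge0 ?expR_ge0// invr_ge0 ltW.
have b0 w : 0 <= b w by rewrite ler0n.
have b1 w : 0 <= 1 - b w by rewrite /b; case: eqP => _; rewrite ?subrr ?subr0.
have W0 x : 0 <= W x by exact: expR_ge0.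
have uT' := ltnW uT.
have pM : past_measurable (s0 + u) M.
  by apply: measurable_funB => //; exact: past_measurable_running_max.
have pA : past_measurable (s0 + u) A.
  apply: measurable_funM => //; apply: measurableT_comp => //.
  apply: measurable_funM => //; apply: measurable_funB.
    exact: past_measurable_sampled_sum.
  exact: past_measurable_running_max.
have pb : past_measurable (s0 + u) b by exact: past_measurable_selected.
have pAb : past_measurable (s0 + u) (fun w => A w * b w) by exact: measurable_funM.
have pAc : past_measurable (s0 + u) (fun w => A w * (1 - b w)).
  by apply: measurable_funM => //; exact: measurable_funB.
have mW : measurable_fun setT W.
  by apply: measurableT_comp => //; apply: measurable_funM.
have mX : measurable_fun setT (X (s0 + u)%N k).
  by apply: past_measurableW; exact: past_measurable_reward.
have mWX : measurable_fun setT (fun w => W (X (s0 + u)%N k w)).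
  exact: (measurableT_comp mW mX).
(* The reward at time [s0 + u] is not a coordinate of the past, hence independent of [A] and [b]. *)
have fresh : ((Ordinal uT, k) \notin past (s0 + u)) by rewrite inE ltnn.
(* Splitting on whether arm [k] is selected makes the bound affine in the fresh factor [W], with
   coefficients that depend on the past only. *)
have step w : potential y u.+1 w <=
    M w + A w * (1 - b w) + A w * b w * W (X (s0 + u)%N k w).
  rewrite /potential [X in X - y](_ : _ =
     Num.max (running_max y u w) (sampled_sum u.+1 w))//.
  have := max_expR_step (running_max y u w) (sampled_sum u.+1 w) lam0.
  move=> maxs; apply: (@le_trans _ _ (running_max y u w - y +
      lam^-1 * expR (lam * (sampled_sum u.+1 w - running_max y u w)))).
    by move: maxs; rewrite /=; lra.
  rewrite /M -!addrA; do 2 apply: lerD => //.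
  rewrite sampled_sumS -/(b w) addrAC (mulrDr lam) expRD (mulrA lam^-1) -/(A w).
  rewrite -mulrA -mulrDr /b /W.
  case: eqP => _; first by rewrite subrr add0r !mul1r.
  by rewrite mul0r mulr0 expR0 subr0 mul0r addr0.
have mE (g : Omega -> R) : measurable_fun setT g ->
  measurable_fun setT (fun w => (g w)%:E) by move=> mg; apply/measurable_EFinP.
have mpot v : (s0 + v <= T)%N -> measurable_fun setT (potential y v).
  move=> vT; apply: (@past_measurableW (s0 + v)); apply: measurable_funD.
    by apply: measurable_funB => //; exact: past_measurable_running_max.
  apply: measurable_funM => //; apply: measurableT_comp => //.
  apply: measurable_funM => //; apply: measurable_funB.
    exact: past_measurable_sampled_sum.
  exact: past_measurable_running_max.
apply: (@le_trans _ _ (\int[P]_w ((M w + A w * (1 - b w)) +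
    A w * b w * W (X (s0 + u)%N k w))%:E)%E).
  apply: ge0_le_integral => //.
  - by move=> w _; rewrite lee_fin.
  - by apply: mE; apply: mpot; rewrite addnS.
  - apply: mE; apply: measurable_funD; last first.
      by apply: measurable_funM => //; exact: past_measurableW pAb.
    by apply: measurable_funD; [exact: past_measurableW pM|exact: past_measurableW pAc].
  - by move=> w _; rewrite lee_fin.
under eq_integral do rewrite EFinD.
rewrite ge0_integralD//; last 4 first.
- by move=> w _; rewrite lee_fin addr_ge0// mulr_ge0.
- apply: mE.
  by apply: measurable_funD; [exact: past_measurableW pM|exact: past_measurableW pAc].
- by move=> w _; rewrite lee_fin; apply: mulr_ge0 => //; exact: mulr_ge0.
- by apply: mE; apply: measurable_funM => //; exact: past_measurableW pAb.
rewrite (@integral_past_indep _ _ _ _ _ _ indep _ _ fresh (fun w => A w * b w) W)//;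
  last by move=> w; rewrite mulr_ge0.
(* The fresh factor has expectation at most 1; without it the terms recombine into [M + A], the
   potential at [u]. *)
apply: (@le_trans _ _ (\int[P]_w (M w + A w * (1 - b w))%:E +
    \int[P]_w (A w * b w)%:E)%E).
  apply: leeD => //; rewrite -[leRHS]mule1; apply: lee_wpmul2l.
    by apply: integral_ge0 => w _; rewrite lee_fin mulr_ge0.
  by apply: mgf_le1; rewrite leq_addr.
rewrite -ge0_integralD//; last 4 first.
- by move=> w _; rewrite lee_fin addr_ge0// mulr_ge0.
- apply: mE.
  by apply: measurable_funD; [exact: past_measurableW pM|exact: past_measurableW pAc].
- by move=> w _; rewrite lee_fin; exact: mulr_ge0.
- by apply: mE; exact: past_measurableW pAb.
rewrite le_eqVlt; apply/orP; left; apply/eqP; apply: eq_integral => w _.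
by rewrite -EFinD /potential -/(M w) -/(A w); congr _%:E; ring.
Qed.

Lemma measurable_running_max y u : (s0 + u <= T)%N ->
  measurable_fun setT (running_max y u).
Proof.
by move=> uT; apply: (@past_measurableW (s0 + u)); exact: past_measurable_running_max.
Qed.

(** [potential] dominates the excess, does not increase in expectation, and at [u = 0] equals the
    right-hand side, since the sum is then 0 and the maximum [y]. *)
Lemma integral_running_max y u : (s0 + u <= T)%N ->
  (\int[P]_w (running_max y u w - y)%:E <= (lam^-1 * expR (- (lam * y)))%:E)%E.
Proof.
move=> uT.
have mpot v : (s0 + v <= T)%N -> measurable_fun setT (potential y v).
  move=> vT; apply: (@past_measurableW (s0 + v)); apply: measurable_funD.
    by apply: measurable_funB => //; exact: past_measurable_running_max.
  apply: measurable_funM => //; apply: measurableT_comp => //.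
  apply: measurable_funM => //; apply: measurable_funB.
    exact: past_measurable_sampled_sum.
  exact: past_measurable_running_max.
apply: (@le_trans _ _ (\int[P]_w (potential y u w)%:E)%E).
  apply: ge0_le_integral => //.
  - by move=> w _; rewrite lee_fin subr_ge0 running_max_ge_start.
  - by apply/measurable_EFinP; apply: measurable_funB => //; exact: measurable_running_max.
  - by apply/measurable_EFinP; exact: mpot.
  - move=> w _; rewrite lee_fin lerDl mulr_ge0 ?expR_ge0// invr_ge0; exact: ltW.
elim: u uT => [_|u IHu uT]; last first.
  apply: le_trans (potential_step y _) (IHu _); rewrite ?addnS in uT *; first exact: uT.
  exact: ltnW.
rewrite (eq_integral (fun=> (lam^-1 * expR (- (lam * y)))%:E)).
  by rewrite integral_cst//= probability_setT mule1.
move=> w _; rewrite /potential /= /sampled_sum big_ord0 subrr add0r sub0r.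
by rewrite mulrN.
Qed.

End AdaptedSampling.

(** * The saturation function *)

Section Truncation.
Context {R : realType}.
Implicit Types (x B : R).

Lemma sat_normE x B : 0 <= B -> `|sat x B| = Num.min `|x| B.
Proof.
move=> B0; rewrite /sat normrM normr_sg.
have [->|x0] := eqVneq x 0; last by rewrite mul1r ger0_norm// le_min normr_ge0.
by rewrite mul0r normr0 minEle B0.
Qed.

Lemma sat_norm_le x B : 0 <= B -> `|sat x B| <= B.
Proof. by move=> B0; rewrite sat_normE// ge_min lexx orbT. Qed.

Lemma sat_sqr_le x B : 0 <= B -> sat x B ^+ 2 <= x ^+ 2.
Proof.
move=> B0; rewrite -(real_normK (num_real (sat x B))) -(real_normK (num_real x)).
by rewrite lerXn2r ?nnegrE// sat_normE// ge_min lexx.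
Qed.

(** Only [|x| > B] contributes, and there [|x| - B <= x ^+ 2 / B]. *)
Lemma sat_dist_le x B : 0 < B -> `|sat x B - x| <= B^-1 * x ^+ 2.
Proof.
move=> B0; rewrite /sat [X in _ - X](numEsg x) -mulrBr normrM normr_sg.
have [->|x0] := eqVneq x 0; first by rewrite mul0r mulr_ge0 ?invr_ge0 ?sqr_ge0// ltW.
rewrite mul1r minEle; case: ifPn => [_|].
  by rewrite subrr normr0 mulr_ge0 ?invr_ge0 ?sqr_ge0// ltW.
rewrite -ltNge => Bx; rewrite ler0_norm ?opprB; last by rewrite subr_le0 ltW.
rewrite -(ler_pM2l B0) mulrA mulfV ?gt_eqF// mul1r -(real_normK (num_real x)).
have x0' := normr_ge0 x; nra.
Qed.

Lemma measurable_sat B : measurable_fun setT (fun x => sat x B).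
Proof.
have -> : (fun x => sat x B) = (fun x => if 0 < x then Num.min `|x| B else
    if x < 0 then - Num.min `|x| B else 0).
  apply/funext => x; rewrite /sat; have [x0|x0|->] := ltrgt0P x.
  - by rewrite gtr0_sg// mul1r.
  - by rewrite ltr0_sg// mulN1r.
  - by rewrite sgr0 mul0r.
have mm : measurable_fun [set: R] (fun x => Num.min `|x| B).
  by apply: measurable_minr => //; exact: measurableT_comp.
apply: measurable_fun_ifT => //; first exact: measurable_fun_ltr.
apply: measurable_fun_ifT => //; first exact: measurable_fun_ltr.
exact: measurableT_comp.
Qed.

End Truncation.

(** * Moments of a truncated reward *)

Section TruncatedMoments.
Context {R : realType}.
Variable mu : probability R R.
Hypothesis second_moment : (\int[mu]_x ((x ^+ 2)%:E) <= 1)%E.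

(** Domination by a function that is integrable thanks to the second moment; the integrability of
    the reward, its square and its truncations reduces to this. *)
Lemma integrable_quadratic_growth (g : R -> R) (c : R) :
  measurable_fun setT g -> (forall x, `|g x| <= c * (1 + x ^+ 2)) ->
  mu.-integrable setT (EFin \o g).
Proof.
move=> mg gc.
have mx2 : measurable_fun [set: R] (fun x : R => x ^+ 2) by exact: measurable_funX.
have i2 : mu.-integrable setT (EFin \o (fun x : R => x ^+ 2)).
  apply/integrableP; split; first exact/measurable_EFinP.
  apply: (@le_lt_trans _ _ 1%E); last exact: ltry.
  apply: le_trans second_moment; rewrite le_eqVlt; apply/orP; left; apply/eqP.
  by apply: eq_integral => x _ /=; rewrite ger0_norm// sqr_ge0.
have i1 : mu.-integrable setT (EFin \o cst (1 : R)).
  by apply: finite_measure_integrable_cst.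
have ic := integrableZl measurableT c (integrableD measurableT i1 i2).
apply: (le_integrable _ _ _ ic) => //; first exact/measurable_EFinP.
move=> x _ /=; rewrite lee_fin.
by apply: le_trans (gc x) _; rewrite ler_norm.
Qed.

Let integrable_id : mu.-integrable setT (EFin \o (fun x : R => x)).
Proof.
apply: (@integrable_quadratic_growth _ 1) => // x.
have := sqr_ge0 (`|x| - 1); rewrite sqrrB real_normK ?num_real//; have := normr_ge0 x.
by have := sqr_ge0 x; lra.
Qed.

Let integrable_sqr : mu.-integrable setT (EFin \o (fun x : R => x ^+ 2)).
Proof.
apply: (@integrable_quadratic_growth _ 1) => [|x].
  exact: measurable_funX.
by rewrite ger0_norm ?sqr_ge0// mul1r lerDr.
Qed.

Let integrable_sat B : 0 <= B -> mu.-integrable setT (EFin \o (fun x : R => sat x B)).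
Proof.
move=> B0; apply: (@integrable_quadratic_growth _ B) => [|x].
  exact: measurable_sat.
apply: le_trans (sat_norm_le _ B0) _; rewrite ler_peMr// lerDl sqr_ge0//.
Qed.

Let integrable_cst (c : R) : mu.-integrable setT (EFin \o (fun=> c)).
Proof. exact: finite_measure_integrable_cst. Qed.

Let mean_sqr_le1 : \int[mu]_x (x ^+ 2) <= 1.
Proof.
rewrite /Rintegral -lee_fin fineK//.
have /integrable_fin_num := integrable_sqr; exact.
Qed.

Let mean_cst (c : R) : \int[mu]_x c = c.
Proof. by rewrite Rintegral_cst//= probability_setT mulr1. Qed.

(** For a sign [s], [(s * x - 1) ^+ 2 >= 0] gives [s * x <= (1 + x ^+ 2) / 2], whose integral is at
    most 1. *)
Lemma mean_norm_le1 : `|\int[mu]_x x| <= 1.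
Proof.
have h (s : R) : `|s| = 1 -> s * \int[mu]_x x <= 1.
  move=> s1; rewrite -RintegralZl//.
  apply: (@le_trans _ _ (\int[mu]_x (2^-1 * 1 + 2^-1 * x ^+ 2))).
    apply: le_Rintegral => //.
    - exact: (integrableZl measurableT s integrable_id).
    - apply: (@integrable_quadratic_growth _ 1) => [|x].
        by apply: measurable_funD => //; apply: measurable_funM => //; exact: measurable_funX.
      by have x2 := sqr_ge0 x; rewrite ger0_norm; lra.
    - move=> x _; have : s ^+ 2 = 1 by rewrite -(real_normK (num_real s)) s1 expr1n.
      by have := sqr_ge0 (s * x - 1); rewrite sqrrB exprMn => + s2; rewrite s2; lra.
  rewrite RintegralD//; last exact: (integrableZl measurableT 2^-1 integrable_sqr).
  rewrite mean_cst RintegralZl//.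
  by have := mean_sqr_le1; lra.
rewrite ler_norml; apply/andP; split.
  by have := h (-1); rewrite normrN1 mulN1r => /(_ erefl); lra.
by have := h 1; rewrite normr1 mul1r; apply.
Qed.

Lemma truncated_mean_bias B : 0 < B ->
  `|\int[mu]_x sat x B - \int[mu]_x x| <= B^-1.
Proof.
move=> B0; have B0' := ltW B0.
rewrite -RintegralB//; last exact: integrable_sat.
have isub : mu.-integrable setT (EFin \o (fun x : R => sat x B - x)).
  exact: (integrableB measurableT (integrable_sat B0') integrable_id).
apply: le_trans (le_normr_Rintegral _ isub) _ => //.
apply: (@le_trans _ _ (\int[mu]_x (B^-1 * x ^+ 2))).
  apply: le_Rintegral => //.
  - exact: (integrable_abse isub).
  - exact: (integrableZl measurableT B^-1 integrable_sqr).
  - by move=> x _; exact: sat_dist_le.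
rewrite RintegralZl// -[leRHS]mulr1 ler_wpM2l// ?invr_ge0//.
Qed.

(** Integrating the quadratic bound kills the linear term, and the centered second moment is at most
    1: what is left is [expR (- v) * (1 + v) <= 1]. The abstract hypothesis on [expR] admits both
    Bennett's bound and the elementary one. *)
Lemma truncated_mgf_le1 (B lam v sg : R) : 0 < B -> 0 <= v -> `|sg| = 1 ->
    (forall y, `|y| <= 2 * B -> expR (lam * y) <= 1 + lam * y + v * y ^+ 2) ->
  (\int[mu]_x (expR (lam * (sg * (sat x B - \int[mu]_x sat x B)) - v))%:E <= 1)%E.
Proof.
move=> B0 v0 sg1 expB; have B0' := ltW B0.
set e := \int[mu]_x sat x B.
have eB : `|e| <= B.
  apply: le_trans (le_normr_Rintegral _ (integrable_sat B0')) _ => //.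
  rewrite -[leRHS]mean_cst; apply: le_Rintegral => //.
    exact: (integrable_abse (integrable_sat B0')).
  by move=> x _; exact: sat_norm_le.
have sg2 : sg ^+ 2 = 1 by rewrite -(real_normK (num_real sg)) sg1 expr1n.
(* Coefficients of the quadratic bound after expanding the square and replacing [sat x B ^+ 2] by
   [x ^+ 2]. *)
pose c0 := expR (- v) * (1 - lam * sg * e + v * e ^+ 2).
pose c1 := expR (- v) * (lam * sg - 2 * v * e).
pose c2 := expR (- v) * v.
pose h x := c0 + (c1 * sat x B + c2 * x ^+ 2).
have ev0 := expR_ge0 (- v).
have le_h x : expR (lam * (sg * (sat x B - e)) - v) <= h x.
  have y2 : `|sg * (sat x B - e)| <= 2 * B.
    rewrite normrM sg1 mul1r; apply: le_trans (ler_normB _ _) _.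
    by have := sat_norm_le x B0'; lra.
  rewrite addrC expRD.
  apply: (@le_trans _ _ (expR (- v) * (1 + lam * (sg * (sat x B - e)) +
      v * (sg * (sat x B - e)) ^+ 2))).
    by rewrite ler_wpM2l// expB.
  rewrite exprMn sg2 mul1r /h /c0 /c1 /c2.
  rewrite [leRHS](_ : _ = expR (- v) * (1 + lam * (sg * (sat x B - e)) +
      v * (x ^+ 2 - 2 * e * sat x B + e ^+ 2))); last by ring.
  rewrite ler_wpM2l// lerD2l ler_wpM2l//.
  by have := sat_sqr_le x B0'; rewrite sqrrB; lra.
have ih1 : mu.-integrable setT (EFin \o (fun x : R => c1 * sat x B)).
  exact: (integrableZl measurableT c1 (integrable_sat B0')).
have ih2 : mu.-integrable setT (EFin \o (fun x : R => c2 * x ^+ 2)).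
  exact: (integrableZl measurableT c2 integrable_sqr).
have ih12 : mu.-integrable setT (EFin \o (fun x : R => c1 * sat x B + c2 * x ^+ 2)).
  exact: (integrableD measurableT ih1 ih2).
have ih : mu.-integrable setT (EFin \o h).
  exact: (integrableD measurableT (integrable_cst c0) ih12).
have mh : measurable_fun setT h by apply/measurable_EFinP; exact: (measurable_int mu).
apply: (@le_trans _ _ (\int[mu]_x (h x)%:E)%E).
  apply: ge0_le_integral => //.
  - apply/measurable_EFinP; apply: measurableT_comp => //.
    apply: measurable_funB => //; apply: measurable_funM => //.
    apply: measurable_funM => //; apply: measurable_funB => //.
    exact: measurable_sat.
  - exact/measurable_EFinP.
  - by move=> x _; rewrite lee_fin.
rewrite -[leLHS]fineK; last exact: (integrable_fin_num _ ih).
rewrite lee_fin -/(Rintegral mu setT h) /h RintegralD//.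
rewrite mean_cst RintegralD// !RintegralZl//; last exact: integrable_sat.
rewrite -/e /c0 /c1 /c2.
apply: (@le_trans _ _ (expR (- v) * (1 + v))); last first.
  apply: (@le_trans _ _ (expR (- v) * expR v)); last by rewrite -expRD addNr expR0.
  by rewrite ler_wpM2l// expR_ge1Dx.
rewrite [leLHS](_ : _ = expR (- v) * (1 + v * (\int[mu]_x (x ^+ 2) - e ^+ 2))); last by ring.
rewrite ler_wpM2l// lerD2l ler_piMr//.
by have := mean_sqr_le1; have := sqr_ge0 e; lra.
Qed.

End TruncatedMoments.

(** * Elementary bounds on exponentials and on sums *)

Section RealBounds.
Import numFieldNormedType.Exports.
Context {R : realType}.
Implicit Types x y a b c l u : R.

Lemma sum_le_telescope (F g : nat -> R) n :
  (forall i, F i <= g i.+1 - g i) -> \sum_(i < n) F i <= g n - g 0%N.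
Proof.
move=> Fg; elim: n => [|n IHn]; first by rewrite big_ord0 subrr.
by rewrite big_ord_recr /=; have := Fg n; lra.
Qed.

(** Division-free form of the monotonicity of [(expR x - 1 - x) / x ^+ 2], obtained by comparing
    partial sums of the exponential series term by term. *)
Lemma expR_taylor2_le x b : `|x| <= b ->
  b ^+ 2 * (expR x - 1 - x) <= x ^+ 2 * (expR b - 1 - b).
Proof.
move=> xb; have b0 : 0 <= b by exact: le_trans xb.
have cvg_tail (c y : R) :
    (fun n => c * (series (exp_coeff y) n - 1 - y)) @ \oo --> c * (expR y - 1 - y).
  apply: cvgM; first exact: cvg_cst.
  apply: cvgB; last exact: cvg_cst.
  by apply: cvgB; [exact: is_cvg_series_exp_coeff|exact: cvg_cst].
apply: (ler_cvg_to (cvg_tail (b ^+ 2) x) (cvg_tail (x ^+ 2) b)).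
(* After two terms the partial sum is [1 + y], so both sides start from 0. *)
exists 2%N => // n /= n2; rewrite -(subnK n2) addn2.
move: (n - 2)%N => {n2}n; elim: n => [|n IHn].
  have e (y : R) : series (exp_coeff y) 2 = 1 + y.
    by rewrite /series /= !big_nat_recr//= big_geq// /exp_coeff /= add0r expr0 expr1 !divr1.
  by rewrite !e; lra.
have seriesS (y : R) m : series (exp_coeff y) m.+1 = series (exp_coeff y) m + exp_coeff y m.
  by rewrite /series /= big_nat_recr.
rewrite !(seriesS _ n.+2).
apply: (@le_trans _ _ (x ^+ 2 * (series (exp_coeff b) n.+2 - 1 - b) +
  b ^+ 2 * exp_coeff x n.+2)).
  by move: IHn; lra.
suff : b ^+ 2 * exp_coeff x n.+2 <= x ^+ 2 * exp_coeff b n.+2.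
  by lra.
rewrite /exp_coeff /= -[n.+2]addn2 !exprD !mulrA ler_wpM2r ?invr_ge0//.
rewrite [leLHS](_ : _ = (b ^+ 2 * x ^+ 2) * x ^+ n); last by ring.
rewrite [leRHS](_ : _ = (b ^+ 2 * x ^+ 2) * b ^+ n); last by ring.
have xnbn : x ^+ n <= b ^+ n.
  apply: le_trans (ler_norm _) _; rewrite (@normrX R).
  by rewrite lerXn2r ?nnegrE.
by rewrite ler_wpM2l// mulr_ge0 ?sqr_ge0.
Qed.

(** From [expR (- x) >= 1 - x] one gets [expR x <= 1 / (1 - x)], which the quadratic dominates for
    [x <= 1/2]. *)
Lemma expR_quadratic_le x : `|x| <= 2^-1 -> expR x <= 1 + x + 2 * x ^+ 2.
Proof.
rewrite ler_norml => /andP[xl xu].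
have x0 := sqr_ge0 x.
have e0 : 0 < 1 - x by lra.
have : expR x * (1 - x) <= 1.
  rewrite -[leRHS](expRxMexpNx_1 x) ler_wpM2l ?expR_ge0//.
  exact: expR_ge1Dx.
rewrite -ler_pdivlMr// => h; apply: le_trans h _.
rewrite ler_pdivrMr//.
have : 0 <= x ^+ 2 * (1 - 2 * x) by rewrite mulr_ge0//; lra.
nra.
Qed.

(** This is [expR_taylor2_le] at [b = l]: the rate [l / (2 * B)] maps the range of [y] into
    [[-l, l]], and [expR l - 1 - l] is [u - l]. *)
Lemma bennett_mgf u l B y : 0 < l -> expR l = 1 + u -> 0 < B -> `|y| <= 2 * B ->
  expR (l / (2 * B) * y) <= 1 + l / (2 * B) * y + (u - l) / (4 * B ^+ 2) * y ^+ 2.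
Proof.
move=> l0 el B0 yB; have lamy : `|l / (2 * B) * y| <= l.
  rewrite normrM gtr0_norm; last by rewrite divr_gt0// mulr_gt0.
  by rewrite mulrAC ler_pdivrMr ?mulr_gt0// ler_pM2l.
have := expR_taylor2_le lamy.
rewrite el (_ : 1 + u - 1 - l = u - l); last by ring.
move: (expR _) => E h.
have l2 : 0 < l ^+ 2 by rewrite exprn_gt0.
have {}h : E - 1 - l / (2 * B) * y <= (u - l) / (4 * B ^+ 2) * y ^+ 2.
  rewrite -(ler_pM2l l2); apply: le_trans h _.
  rewrite le_eqVlt; apply/orP; left; apply/eqP.
  by field; rewrite gt_eqF.
by rewrite -lerBlDl; move: h; rewrite opprD addrA.
Qed.

(** Comparison with an integral: [- (2 / c) * expR (- (c * sqrt t))] is a primitive of the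
    decreasing function [expR (- (c * sqrt t)) / sqrt t]. *)
Lemma sum_sqrt_expR_le c n : 0 < c ->
  \sum_(i < n) (Num.sqrt i.+1%:R)^-1 * expR (- (c * Num.sqrt i.+1%:R)) <= 2 / c.
Proof.
move=> c0.
apply: (@le_trans _ _ (- (2 / c * expR (- (c * Num.sqrt n%:R)))
    - - (2 / c * expR (- (c * Num.sqrt 0%:R))))); last first.
  rewrite sqrtr0 mulr0 oppr0 expR0 mulr1 opprK addrC gerDl oppr_le0.
  by rewrite mulr_ge0 ?expR_ge0// divr_ge0// ltW.
apply: (@sum_le_telescope
  (fun i => (Num.sqrt i.+1%:R)^-1 * expR (- (c * Num.sqrt i.+1%:R)))
  (fun i => - (2 / c * expR (- (c * Num.sqrt i%:R))))) => i.
set s := Num.sqrt i.+1%:R; set r := Num.sqrt i%:R.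
have s0 : 0 < s by rewrite sqrtr_gt0.
have r0 : 0 <= r by rewrite sqrtr_ge0.
have s2 : s ^+ 2 = r ^+ 2 + 1 by rewrite !sqr_sqrtr ?ler0n// -natr1.
have rs : (2 * s)^-1 <= s - r.
  by rewrite -(ler_pM2l (_ : 0 < 2 * s)) ?mulr_gt0// mulfV ?gt_eqF ?mulr_gt0//; nra.
rewrite opprK addrC -mulrBr.
rewrite -(ler_pM2l c0) [leRHS](_ : _ =
  2 * (expR (- (c * r)) - expR (- (c * s)))); last by field; rewrite gt_eqF.
have -> : expR (- (c * r)) = expR (- (c * s)) * expR (c * (s - r)).
  by rewrite -expRD; congr expR; ring.
have es := expR_gt0 (- (c * s)).
have h1 := expR_ge1Dx (c * (s - r)).
have h2 : c * (2 * s)^-1 <= c * (s - r) by rewrite ler_pM2l.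
have -> : s^-1 = 2 * (2 * s)^-1 by field; rewrite gt_eqF.
rewrite [leLHS](_ : _ = expR (- (c * s)) * (2 * (c * (2 * s)^-1))); last first.
  by field; rewrite gt_eqF.
rewrite [leRHS](_ : _ = expR (- (c * s)) * (2 * (expR (c * (s - r)) - 1))); last by ring.
by rewrite ler_pM2l//; lra.
Qed.

(** Consecutive values of [x / (1 + x)] along [x = q * r ^+ i] differ by at least a constant times
    the minimum of [x] and [1 / x], and they stay in [[0, 1]]: the bound depends on neither [q] nor
    [n]. *)
Lemma sum_geometric_min_le (q r : R) n : 0 < q -> 1 < r ->
  \sum_(i < n) Num.min (q * r ^+ i) (q * r ^+ i)^-1 <= 2 * (r + 1) / (r - 1).
Proof.
move=> q0 r1; have r0 : 0 < r by lra.
pose C := 2 * (r + 1) / (r - 1).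
have C0 : 0 < C by rewrite divr_gt0//; lra.
pose x i := q * r ^+ i.
have x0 i : 0 < x i by rewrite mulr_gt0// exprn_gt0.
apply: (@le_trans _ _ (C * (x n / (1 + x n)) - C * (x 0%N / (1 + x 0%N)))); last first.
  have h y : 0 < y -> 0 <= y / (1 + y) <= 1.
    by move=> y0; rewrite divr_ge0 ?ler_pdivrMr ?mul1r; lra.
  have /andP[_ hn] := h _ (x0 n); have /andP[hz _] := h _ (x0 0%N).
  by rewrite -/C; nra.
apply: (@sum_le_telescope (fun i => Num.min (q * r ^+ i) (q * r ^+ i)^-1)
  (fun i => C * (x i / (1 + x i)))) => i /=.
rewrite -/(x i) (_ : x i.+1 = r * x i); last by rewrite /x exprS; ring.
have y0 := x0 i; move: (x i) y0 => y y0.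
have ry0 : 0 < r * y by rewrite mulr_gt0.
rewrite -mulrBr.
rewrite [leRHS](_ : _ = 2 * (r + 1) * y / ((1 + r * y) * (1 + y))); last first.
  by rewrite /C; field; rewrite !gt_eqF//; lra.
rewrite ler_pdivlMr; last by rewrite mulr_gt0//; lra.
have [y1|y1] := leP y 1.
  rewrite min_l; last by rewrite -[leRHS]mul1r ler_pdivlMr//; nra.
  rewrite mulrC ler_pM2r//.
  by nra.
rewrite min_r; last by rewrite -[leLHS]mul1r ler_pdivrMr//; nra.
rewrite mulrC ler_pdivrMr//.
by nra.
Qed.

End RealBounds.

(** * Confidence widths and truncation levels *)

Section ConfidenceWidths.
Context {R : realType}.
Implicit Types x y a h : R.

Lemma lnp_ge1 x : 1 <= lnp x.
Proof. by rewrite /lnp le_max lexx orbT. Qed.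

Lemma lnp_gt0 x : 0 < lnp x.
Proof. exact: lt_le_trans ltr01 (lnp_ge1 x). Qed.

Lemma le_lnp x y : 0 < x -> x <= y -> lnp x <= lnp y.
Proof.
move=> x0 xy; rewrite /lnp ge_max !le_max lexx orbT andbT.
by rewrite ler_ln ?posrE ?xy// (lt_le_trans x0).
Qed.

Lemma lnp_le1 x : x <= 1 -> lnp x = 1.
Proof.
move=> x1; rewrite /lnp; apply: max_r.
by apply: le_trans (ln_le0 x1) _.
Qed.

Lemma expRN_lnp_le x : 0 < x -> expR (- lnp x) <= x^-1.
Proof.
move=> x0; rewrite expRN lef_pV2 ?posrE ?expR_gt0//.
rewrite -[leLHS](lnK (_ : x \in Num.pos)) ?posrE// ler_expR.
by rewrite /lnp le_max lexx.
Qed.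

Lemma lnp_le_sqrt x : 1 <= x -> lnp x <= 2 * Num.sqrt x.
Proof.
move=> x1; have x0 : 0 < x by exact: lt_le_trans x1.
have s1 : 1 <= Num.sqrt x by rewrite -[leLHS]sqrtr1 ler_wsqrtr.
rewrite /lnp ge_max; apply/andP; split; last by lra.
have -> : ln x = 2 * ln (Num.sqrt x).
  have {1}-> : x = Num.sqrt x ^+ 2 by rewrite sqr_sqrtr// ltW.
  by rewrite lnXn ?sqrtr_gt0// mulr_natl.
by rewrite ler_pM2l// ltW// ln_sublinear// sqrtr_gt0.
Qed.

(** The exponent of [a] in [hfun a m] as a natural number; for [m > 0] the floor is nonnegative, so
    the absolute value leaves it unchanged. *)
Definition level (a : R) (m : nat) : nat :=
  (`|Num.floor (ln (m%:R : R) / ln a)|%N).+1.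

Section Levels.
Variables (a : R) (m : nat).
Hypotheses (a1 : 1 < a) (m0 : (0 < m)%N).

Let a0 : 0 < a. Proof. exact: lt_trans a1. Qed.
Let lna : 0 < ln a. Proof. exact: ln_gt0. Qed.
Let z := Num.floor (ln (m%:R : R) / ln a).

Let z_ge0 : 0 <= z.
Proof. by rewrite /z floor_ge0 divr_ge0 ?ln_ge0 ?ler1n// ltW. Qed.

Lemma hfunE : hfun a m = a ^+ level a m.
Proof.
rewrite /hfun /level -/z exprS powRD; last by rewrite (gt_eqF a0) implybT.
rewrite powRr1 ?(ltW a0)// mulrC; congr (_ * _).
by rewrite powR_intmul ?(ltW a0)// -{1}(gez0_abs z_ge0).
Qed.

Lemma hfun_gt0 : 0 < hfun a m.
Proof. by rewrite hfunE exprn_gt0. Qed.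

Lemma hfun_ge : m%:R <= hfun a m.
Proof.
have m0' : (0 : R) < m%:R by rewrite ltr0n.
rewrite /hfun /powR gt_eqF// -[leLHS](lnK (_ : m%:R \in Num.pos)) ?posrE//.
rewrite ler_expR -ler_pdivrMr// ltW//.
by have := floorD1_gt (ln (m%:R : R) / ln a); rewrite intrD.
Qed.

Lemma hfun_le : hfun a m <= a * m%:R.
Proof.
have m0' : (0 : R) < m%:R by rewrite ltr0n.
rewrite /hfun powRD; last by rewrite (gt_eqF a0) implybT.
rewrite powRr1 ?(ltW a0)// mulrC ler_pM2l//.
rewrite /powR gt_eqF// -[leRHS](lnK (_ : m%:R \in Num.pos)) ?posrE//.
by rewrite ler_expR -ler_pdivlMr// floor_le.
Qed.

End Levels.

Section Widths.
Variables (K H : nat).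
Hypotheses (K0 : (0 < K)%N) (H0 : (0 < H)%N).

(** The width [cm] extended to real arguments: [cm] is its value at a pull count, and [Bm] the
    inverse of its value at [hfun a m]. *)
Definition width h : R := Num.sqrt (lnp (H%:R / (K%:R * h)) / h).

Let K0' : (0 : R) < K%:R. Proof. by rewrite ltr0n. Qed.
Let H0' : (0 : R) < H%:R. Proof. by rewrite ltr0n. Qed.

Lemma width_gt0 h : 0 < h -> 0 < width h.
Proof. by move=> h0; rewrite sqrtr_gt0 divr_gt0// lnp_gt0. Qed.

Lemma width_le h h' : 0 < h -> h <= h' -> width h' <= width h.
Proof.
move=> h0 hh'; have h'0 := lt_le_trans h0 hh'.
apply: ler_wsqrtr; apply: ler_pM => //.
- by rewrite ltW// lnp_gt0.
- by rewrite invr_ge0 ltW.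
- apply: le_lnp; first by rewrite divr_gt0 ?mulr_gt0.
  by rewrite ler_pM2l// lef_pV2 ?posrE ?mulr_gt0// ler_pM2l.
- by rewrite lef_pV2.
Qed.

Lemma cmE m : cm R K H m = width m%:R.
Proof. by []. Qed.

Lemma BmE a m : 1 < a -> (0 < m)%N -> Bm K a H m = (width (hfun a m))^-1.
Proof.
move=> a1 m0; rewrite /Bm /width -sqrtrV ?invf_div//.
by rewrite divr_ge0// ltW ?lnp_gt0// hfun_gt0.
Qed.

Lemma Bm_gt0 a m : 1 < a -> (0 < m)%N -> 0 < Bm K a H m.
Proof. by move=> a1 m0; rewrite BmE// invr_gt0 width_gt0// hfun_gt0. Qed.

(** The truncation bias is at most the inverse of the level, so this is what lets one confidence
    width absorb it. *)
Lemma Bm_inv_le a m : 1 < a -> (0 < m)%N -> (Bm K a H m)^-1 <= cm R K H m.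
Proof.
by move=> a1 m0; rewrite BmE// invrK cmE; apply: width_le; rewrite ?ltr0n ?hfun_ge.
Qed.

Lemma Bm_le a m : 1 < a -> (0 < m)%N -> Bm K a H m <= Num.sqrt (a * m%:R).
Proof.
move=> a1 m0; apply: ler_wsqrtr.
apply: le_trans (hfun_le a1 m0).
rewrite ler_pdivrMr ?lnp_gt0// ler_peMr ?lnp_ge1//.
by rewrite ltW// hfun_gt0.
Qed.

Definition eps : R := Num.sqrt (K%:R / H%:R).

Lemma eps_gt0 : 0 < eps.
Proof. by rewrite sqrtr_gt0 divr_gt0. Qed.

(** With [u = 2 * zeta / a] and [l = ln (1 + u)], this rate and [lower_drift] are the coefficients
    [l / (2 * B)] and [(u - l) / (4 * B ^+ 2)] of [bennett_mgf]. *)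
Definition lower_rate (a zeta B : R) : R := ln (1 + 2 * zeta / a) / (2 * B).

Definition lower_drift (a zeta B : R) : R :=
  (2 * zeta / a - ln (1 + 2 * zeta / a)) / (4 * B ^+ 2).

(** Threshold for the maximal inequality: a deviation [zeta * width h] for each of at least [h / a]
    pulls, less a compensator of drift over rate for each of at most [h] pulls. *)
Definition lower_start (a zeta h : R) : R :=
  h * zeta * width h / a -
  lower_drift a zeta (width h)^-1 * h / lower_rate a zeta (width h)^-1.

(** Since [Bm] is at most [sqrt (a * m)], this rate times a centered truncated reward is at most
    [1/2] in absolute value, as [expR_quadratic_le] requires; its coefficient 2 gives
    [upper_drift]. *)
Definition upper_rate (a : R) (m : nat) : R := (4 * Num.sqrt (a * m%:R))^-1.

Definition upper_drift (a : R) (m : nat) : R := 2 * upper_rate a m ^+ 2.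

Definition upper_start (a : R) (m : nat) : R :=
  m%:R * eps - upper_drift a m * m%:R / upper_rate a m.

(* With [u = 2 zeta / a], the hypothesis reads [u * psi u >= 4], which makes the
   Chernoff exponent of the level at least [lnp (H / (K h))]. *)
Lemma lower_level_bound (a zeta h : R) : 1 < a -> 0 < zeta ->
    psi (2 * zeta / a) >= 2 * a / zeta -> 0 < h ->
  a / h * ((lower_rate a zeta (width h)^-1)^-1 *
    expR (- (lower_rate a zeta (width h)^-1 * lower_start a zeta h))) <=
    2 * a / ln (1 + 2 * zeta / a) * eps *
      Num.min (eps * Num.sqrt h) (eps * Num.sqrt h)^-1.
Proof.
move=> a1 zeta0 psi_ge h0; rewrite /lower_start /lower_drift.
set B := (width h)^-1; set lam := lower_rate a zeta B.
set u := 2 * zeta / a; set l := ln (1 + u); set v := (u - l) / (4 * B ^+ 2).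
set y := h * zeta * width h / a - v * h / lam.
have a0 : 0 < a by exact: lt_trans a1.
have u0 : 0 < u by rewrite divr_gt0// mulr_gt0.
have l0 : 0 < l by rewrite ln_gt0// ltrDl.
have w0 := width_gt0 h0.
have e0 := eps_gt0.
set L := lnp (H%:R / (K%:R * h)).
have L1 : 1 <= L by exact: lnp_ge1.
have sh0 : 0 < Num.sqrt h by rewrite sqrtr_gt0.
have hw2 : h * width h ^+ 2 = L.
  by rewrite sqr_sqrtr ?divr_ge0 ?(ltW h0) ?(ltW (lnp_gt0 _))// mulrC divfK ?gt_eqF.
have exponent : L <= lam * y.
  have -> : lam * y = L / 4 * (u * l - u + l).
    rewrite -hw2 /y /lam /lower_rate -/u -/l /v /B /u; field.
    by rewrite !gt_eqF.
  have : 4 <= u * l - u + l.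
    have := psi_ge; rewrite /psi -/u -/l.
    have -> : 2 * a / zeta = 4 / u by rewrite /u; field; rewrite !gt_eqF.
    rewrite ler_pdivrMr// => h4; apply: le_trans h4 _.
    rewrite le_eqVlt; apply/orP; left; apply/eqP.
    by field; rewrite gt_eqF.
  move: (u * l - u + l) => E E4.
  by rewrite -[leLHS]mulr1 -mulrA ler_pM2l ?(lt_le_trans ltr01)//; lra.
set q := eps * Num.sqrt h.
have q0 : 0 < q by rewrite mulr_gt0.
have q2 : expR (- L) <= q ^+ 2.
  apply: le_trans (expRN_lnp_le _) _; first by rewrite divr_gt0// mulr_gt0.
  rewrite /q exprMn !sqr_sqrtr ?divr_ge0 ?ler0n ?(ltW h0)// invf_div.
  by rewrite mulrAC.
have eL1 : expR (- L) <= 1 by rewrite expR_le1; lra.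
(* Dividing the bounds [q ^+ 2] and 1 on [expR (- L)] by [q] yields the two arguments of the
   minimum; they meet at [h = H / K]. *)
have eLq : expR (- L) / q <= Num.min q q^-1.
  rewrite le_min; apply/andP; split; first by rewrite ler_pdivrMr// -expr2.
  by rewrite -[leRHS]mul1r ler_pM2r// invr_gt0.
(* The product is the square root of [L]; this trades [h * width h] in the denominator for
   [sqrt h]. *)
have shw : 1 <= Num.sqrt h * width h.
  rewrite /width -sqrtrM ?(ltW h0)// -/L mulrC divfK ?gt_eqF//.
  by rewrite -[leLHS]sqrtr1 ler_wsqrtr.
have Ey : expR (- (lam * y)) <= expR (- L) by rewrite ler_expR lerN2.
have -> : a / h * (lam^-1 * expR (- (lam * y))) =
    2 * a / l * (expR (- (lam * y)) / (h * width h)).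
  by rewrite /lam /lower_rate -/u -/l /B; field; rewrite !gt_eqF.
rewrite -[leRHS]mulrA ler_pM2l; last by rewrite divr_gt0// mulr_gt0.
apply: le_trans (_ : eps * (expR (- L) / q) <= _); last by rewrite ler_pM2l.
have -> : eps * (expR (- L) / q) = expR (- L) / Num.sqrt h.
  by rewrite /q; field; rewrite !gt_eqF.
apply: ler_pM; rewrite ?expR_ge0 ?invr_ge0 ?mulr_ge0 ?(ltW h0) ?(ltW w0)//.
rewrite lef_pV2 ?posrE ?mulr_gt0//.
have {2}-> : h = Num.sqrt h * Num.sqrt h by rewrite -expr2 sqr_sqrtr// ltW.
by rewrite -mulrA ler_peMr// ltW.
Qed.

(** The compensator adds only [1 / (8 * a)] to the exponent, absorbed by the factor [expR 1]; the
    rest has the form summed by [sum_sqrt_expR_le]. *)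
Lemma upper_level_bound (a : R) (m : nat) : 1 < a -> (0 < m)%N ->
  m%:R^-1 * ((upper_rate a m)^-1 * expR (- (upper_rate a m * upper_start a m))) <=
    4 * Num.sqrt a * expR 1 *
      ((Num.sqrt m%:R)^-1 * expR (- (eps / (4 * Num.sqrt a) * Num.sqrt m%:R))).
Proof.
move=> a1 m0; rewrite /upper_start /upper_drift.
set lam := upper_rate a m; set v := 2 * lam ^+ 2.
set y := m%:R * eps - v * m%:R / lam.
have a0 : 0 < a by exact: lt_trans a1.
have sa : 0 < Num.sqrt a by rewrite sqrtr_gt0.
set s := Num.sqrt (m%:R : R).
have sm : 0 < s by rewrite sqrtr_gt0 ltr0n.
have lamE : lam = (4 * (Num.sqrt a * s))^-1.
  by rewrite /s /lam /upper_rate sqrtrM// ltW.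
have mE : (m%:R : R) = s ^+ 2 by rewrite /s sqr_sqrtr.
have sa2 : 1 <= Num.sqrt a by rewrite -[leLHS]sqrtr1 ler_wsqrtr// ltW.
have -> : - (lam * y) = - (eps / (4 * Num.sqrt a) * s) +
    (8 * Num.sqrt a ^+ 2)^-1.
  by rewrite /y /v lamE mE; field; rewrite !gt_eqF.
rewrite expRD.
have eE : expR ((8 * Num.sqrt a ^+ 2)^-1) <= expR (1 : R).
  rewrite ler_expR invf_le1; last by rewrite mulr_gt0// exprn_gt0.
  by have : 1 <= Num.sqrt a ^+ 2 by [rewrite exprn_ege1]; lra.
move: (expR (8 * _)^-1) eE => e8 e81.
rewrite [leLHS](_ : _ = 4 * Num.sqrt a * e8 * (s^-1 *
    expR (- (eps / (4 * Num.sqrt a) * s)))); last first.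
  by rewrite lamE mE; field; rewrite !gt_eqF.
apply: ler_wpM2r; first by rewrite mulr_ge0 ?expR_ge0// invr_ge0 ltW.
by rewrite ler_pM2l// mulr_gt0.
Qed.

(** Below [H / K], [lnp x <= 2 * sqrt x] bounds the width by a multiple of
    [(H / K) ^ (1/4) * m ^ (-3/4)], which the increments of [m ^ (1/4)] dominate up to a
    constant. *)
Lemma sum_width_excess_le n :
  \sum_(i < n) Num.max 0 (cm R K H i.+1 - eps) <= 8 / eps.
Proof.
set eta := Num.sqrt eps.
have e0 := eps_gt0.
have eta0 : 0 < eta by rewrite sqrtr_gt0.
have eta2 : eta ^+ 2 = eps by rewrite sqr_sqrtr// ltW.
pose p i : R := Num.sqrt (Num.sqrt i%:R).
(* The fourth root [p] reaches [eta^-1] at [H / K]; from there on the cap freezes the telescoping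
   bound at [8 / eta ^+ 2 = 8 / eps]. *)
pose g i := 8 / eta * Num.min (p i) eta^-1.
have p0 i : 0 <= p i by exact: sqrtr_ge0.
have p_mono i : p i <= p i.+1.
  by apply: ler_wsqrtr; apply: ler_wsqrtr; rewrite ler_nat.
have p4 i : p i ^+ 4 = i%:R.
  by rewrite (exprM _ 2 2) sqr_sqrtr ?sqrtr_ge0// sqr_sqrtr.
apply: (@le_trans _ _ (g n - g 0%N)); last first.
  rewrite lerBlDr; apply: ler_wpDr.
    by rewrite mulr_ge0 ?divr_ge0 ?(ltW eta0)// le_min p0 invr_ge0 ltW.
  rewrite -eta2 expr2 invfM mulrA ler_pM2l; last by rewrite divr_gt0.
  by rewrite ge_min lexx orbT.
apply: (@sum_le_telescope _ (fun i => Num.max 0 (cm R K H i.+1 - eps)) g) => i.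
have g_mono : 0 <= g i.+1 - g i.
  rewrite subr_ge0 ler_pM2l ?divr_gt0// le_min !ge_min lexx orbT andbT.
  by rewrite p_mono.
rewrite ge_max g_mono /=.
set m : R := i.+1%:R; have m0 : 0 < m by rewrite ltr0n.
have k0 : 0 < K%:R * m / H%:R by rewrite divr_gt0// mulr_gt0.
have xE : H%:R / (K%:R * m) = (K%:R * m / H%:R)^-1 by rewrite invf_div.
(* From [m = H / K] on the logarithm is clipped to 1 and the width is at most [eps]: the summand
   vanishes. *)
have [k1|k1] := leP 1 (K%:R * m / H%:R).
  apply: le_trans g_mono; rewrite subr_le0 cmE -/m /width lnp_le1; last first.
    by rewrite xE invf_le1.
  apply: ler_wsqrtr; rewrite mul1r -(ler_pM2r m0) mulVf ?gt_eqF//.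
  by rewrite mulrAC.
have pS0 : 0 < p i.+1 by rewrite sqrtr_gt0 sqrtr_gt0 ltr0n.
have pe : (p i.+1 * eta) ^+ 4 < 1.
  rewrite exprMn p4 (exprM _ 2 2) eta2 sqr_sqrtr ?divr_ge0 ?ler0n//.
  by rewrite mulrA (mulrC _ K%:R).
have pe1 : p i.+1 * eta < 1.
  by rewrite ltNge; apply/negP => h; move: pe; rewrite ltNge exprn_ege1.
have gS : g i.+1 - g i = 8 / eta * (p i.+1 - p i).
  rewrite /g !min_l ?mulrBr//; rewrite -[leRHS]mul1r ler_pdivlMr// ltW//.
  by apply: le_lt_trans pe1; rewrite ler_pM2r.
have cE : cm R K H i.+1 <= 2 / (eta * p i.+1 ^+ 3).
  have D0 : 0 < eta * p i.+1 ^+ 3 by rewrite mulr_gt0// exprn_gt0.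
  rewrite cmE -/m /width -[leRHS]ger0_norm ?divr_ge0 ?(ltW D0)// -sqrtr_sqr.
  apply: ler_wsqrtr; rewrite ler_pdivrMr//.
  apply: le_trans (lnp_le_sqrt _) _; first by rewrite xE invf_ge1// ltW.
  have -> : Num.sqrt (H%:R / (K%:R * m)) = (eta * p i.+1) ^- 2.
    rewrite xE sqrtrV ?(ltW k0)//; congr _^-1.
    rewrite exprMn eta2 /p sqr_sqrtr ?sqrtr_ge0// -sqrtrM ?divr_ge0 ?ler0n//.
    by rewrite mulrAC.
  rewrite /m -(p4 i.+1).
  have -> : (2 / (eta * p i.+1 ^+ 3)) ^+ 2 * p i.+1 ^+ 4 = 4 * (eta * p i.+1) ^- 2.
    by move: (p i.+1) pS0 => s sp; field; rewrite !gt_eqF.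
  by rewrite ler_wpM2r ?invr_ge0 ?sqr_ge0//; lra.
rewrite gS; apply: le_trans (_ : cm R K H i.+1 <= _); first by rewrite gerBl ltW.
apply: le_trans cE _.
set s := p i.+1 in pS0 *; set r := p i.
have r0 : 0 <= r by exact: p0.
have rs : r <= s by exact: p_mono.
have srE : s ^+ 4 = r ^+ 4 + 1 by rewrite !p4 -natr1.
(* From [1 = s ^+ 4 - r ^+ 4], by factoring out [s - r]: the cofactor is at most [4 * s ^+ 3]. *)
have : 1 <= 4 * s ^+ 3 * (s - r).
  rewrite [leLHS](_ : 1 = (s ^+ 3 + s ^+ 2 * r + s * r ^+ 2 + r ^+ 3) * (s - r)); last first.
    rewrite [RHS](_ : _ = s ^+ 4 - r ^+ 4); last by ring.
    by rewrite srE; ring.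
  apply: ler_wpM2r; first by rewrite subr_ge0.
  have rs2 : r ^+ 2 <= s ^+ 2 by rewrite lerXn2r ?nnegrE// (le_trans r0).
  have s0 := ltW pS0.
  have h1 : s ^+ 2 * r <= s ^+ 3 by rewrite [s ^+ 3]exprSr ler_wpM2l ?sqr_ge0.
  have h2 : s * r ^+ 2 <= s ^+ 3 by rewrite [s ^+ 3]exprS ler_wpM2l.
  have h3 : r ^+ 3 <= s ^+ 3 by rewrite lerXn2r ?nnegrE.
  lra.
move=> h.
have D0 : 0 < eta * s ^+ 3 by rewrite mulr_gt0// exprn_gt0.
rewrite ler_pdivrMr//.
rewrite [leRHS](_ : _ = 2 * (4 * s ^+ 3 * (s - r))); last by field; rewrite gt_eqF.
lra.
Qed.

End Widths.
End ConfidenceWidths.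

(** * Pull counts and sums read off the history *)

Section History.
Context {R : realType} {K : nat} {Omega : Type}.
Variables (pi : policy R K) (X : nat -> 'I_K -> Omega -> R).

Definition selected (t : nat) (w : Omega) : 'I_K := pi (history pi X w t).

Definition pulls (s0 : nat) (k : 'I_K) (u : nat) (w : Omega) : nat :=
  \sum_(i < u) (selected (s0 + i) w == k).

Lemma size_history t w : size (history pi X w t) = t.
Proof. by elim: t => //= t IHt; rewrite size_rcons IHt. Qed.

Lemma drop_history0 s0 w : drop s0 (history pi X w (s0 + 0)) = [::].
Proof. by rewrite addn0 drop_oversize// size_history. Qed.

Lemma drop_historyS s0 u w : drop s0 (history pi X w (s0 + u.+1)) =
  rcons (drop s0 (history pi X w (s0 + u)))
    (selected (s0 + u) w, X (s0 + u)%N (selected (s0 + u) w) w).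
Proof. by rewrite addnS /= drop_rcons// size_history leq_addr. Qed.

Lemma npulls_drop s0 k u w :
  npulls (drop s0 (history pi X w (s0 + u))) k = pulls s0 k u w.
Proof.
elim: u => [|u IHu]; first by rewrite drop_history0 /pulls big_ord0.
rewrite drop_historyS /npulls -cats1 count_cat -/(npulls _ k) IHu.
by rewrite /pulls big_ord_recr /= addn0.
Qed.

Lemma sum_drop s0 k u w (F : R -> R) :
  \sum_(p <- drop s0 (history pi X w (s0 + u)) | p.1 == k) F p.2 =
  \sum_(i < u) (selected (s0 + i) w == k)%:R * F (X (s0 + i)%N k w).
Proof.
elim: u => [|u IHu]; first by rewrite drop_history0 big_nil big_ord0.
rewrite drop_historyS -cats1 big_cat /= IHu big_ord_recr /=; congr (_ + _).
rewrite big_cons big_nil /=; case: eqP => [->|_]; last by rewrite mul0r.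
by rewrite mul1r addr0.
Qed.

Lemma pulls_le s0 k u w : (pulls s0 k u w <= u)%N.
Proof.
rewrite /pulls -[leqRHS]card_ord -sum1_card; apply: leq_sum => i _; exact: leq_b1.
Qed.

Lemma pullsS s0 k u w : pulls s0 k u.+1 w = (pulls s0 k u w + (selected (s0 + u) w == k))%N.
Proof. by rewrite /pulls big_ord_recr. Qed.

(* Every pair (arm, number of earlier pulls) occurs at most once. *)
Lemma sum_selected_pulls s0 u w (G : 'I_K -> nat -> R) :
  \sum_(i < u) G (selected (s0 + i) w) (pulls s0 (selected (s0 + i) w) i w) =
  \sum_k \sum_(m < pulls s0 k u w) G k m.
Proof.
elim: u => [|u IHu].
  by rewrite big_ord0 big1// => k _; rewrite /pulls !big_ord0.
rewrite big_ord_recr /= IHu [RHS](bigD1 (selected (s0 + u) w))//=.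
rewrite [X in X + _ = _](bigD1 (selected (s0 + u) w))//=.
rewrite pullsS eqxx addn1 big_ord_recr /= addrAC; congr (_ + _ + _).
by apply: eq_bigr => k; rewrite pullsS eq_sym => /negbTE ->; rewrite addn0.
Qed.

End History.

(** * Adaptedness of the policy *)

Lemma measurable_finite_bool {d} {T : measurableType d} (A : finType)
  (b : A -> T -> bool) (G : {ffun A -> bool} -> bool) :
  (forall x, measurable_fun setT (b x)) ->
  measurable_fun setT (fun w => G [ffun x => b x w]).
Proof.
move=> mb; apply: (measurable_fun_bool true); rewrite setTI.
(* There are finitely many truth patterns, so the preimage is a finite union of finite
   intersections. *)
have -> : (fun w => G [ffun x => b x w]) @^-1` [set true] =
    \bigcup_(g in [set g | G g]) \bigcap_(x in [set: A]) (b x @^-1` [set g x]).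
  apply/seteqP; split=> w /=.
    by move=> Gw; exists [ffun x => b x w] => // x _ /=; rewrite ffunE.
  move=> [g Gg bg]; suff <- : g = [ffun x => b x w] by [].
  by apply/ffunP => x; rewrite ffunE; have /= -> := bg x I.
apply: fin_bigcup_measurable => [|g _]; first exact: finite_finset.
apply: fin_bigcap_measurable => [|x _]; first exact: finite_finset.
by rewrite -[X in measurable X]setTI; exact: mb.
Qed.

Section Adaptedness.
Context {R : realType} {d : measure_display} {Omega : measurableType d}.
Variables (K T : nat) (X : nat -> 'I_K -> Omega -> R).
Variables (k0 : 'I_K) (a zeta : R) (H : nat).
Hypothesis H0 : (0 < H)%N.

Let pi : policy R K := rrmoss k0 a zeta H.
Let phi := selected pi X.

Lemma selected_epoch s0 u w : (H %| s0)%N -> (u < H)%N ->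
  phi (s0 + u) w = robust_moss k0 a zeta H (drop s0 (history pi X w (s0 + u))).
Proof.
move=> Hs0 uH; rewrite /phi /selected {1}/pi /rrmoss size_history.
by rewrite divnDl// (divn_small uH) addn0 divnK.
Qed.

(** The arm as a function of finitely many booleans: [inl] tells which arms are unpulled, [inr] how
    any two indices compare. Adaptedness then reduces to measurability of these tests. *)
Let choose (g : {ffun 'I_K + 'I_K * 'I_K -> bool}) : 'I_K :=
  if [pick k | g (inl k)] is Some k then k
  else odflt k0 [pick i | [forall j, g (inr (j, i))]].

Let robust_mossE hl : robust_moss k0 a zeta H hl =
  choose [ffun x => match x with
    | inl k => npulls hl k == 0%N
    | inr ij => rmoss_index a zeta H hl ij.1 <= rmoss_index a zeta H hl ij.2 end].
Proof.
rewrite /robust_moss /choose.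
rewrite (@eq_pick _ _ (fun k => npulls hl k == 0%N)); last by move=> k; rewrite ffunE.
case: pickP => // _; rewrite /Order.arg_max /extremum; congr odflt.
apply: eq_pick => i /=; apply: eq_forallb => j /=.
by rewrite ffunE.
Qed.

(** Strong induction on time: the indices at [t] are built from earlier rewards and selections of
    the same epoch, the latter measurable by induction. *)
Lemma rrmoss_adapted : adapted T X phi.
Proof.
move=> t; have [n] := ubnP t; elim: n t => // n IHn t tn k tT.
pose s0 := ((t %/ H) * H)%N; pose u := (t %% H)%N.
have tE : t = (s0 + u)%N by exact: divn_eq.
have uH : (u < H)%N by rewrite ltn_mod.
have Hs0 : (H %| s0)%N by rewrite dvdn_mull.
have msel i j : (i < u)%N -> @past_measurable _ _ _ _ T X t _ _
    (fun w => (phi (s0 + i) w == j)%:R : R).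
  move=> iu; have it : (s0 + i < t)%N by rewrite tE ltn_add2l.
  apply: (@past_measurable_mono _ _ _ _ _ _ (s0 + i)); first exact: ltnW.
  have -> : (fun w => (phi (s0 + i) w == j)%:R : R) =
      (fun w => if phi (s0 + i) w == j then 1 else 0) by apply/funext => w; case: eqP.
  apply: measurable_fun_ifT => //.
  by apply: IHn; [apply: leq_trans it _|exact: ltn_trans it tT].
have mN j : @past_measurable _ _ _ _ T X t _ _ (fun w => (pulls pi X s0 j u w)%:R : R).
  rewrite (_ : (fun w => _) =
      fun w => \sum_(i < u) (phi (s0 + i) w == j)%:R); last first.
    by apply/funext => w; rewrite /pulls natr_sum.
  by apply: measurable_sum => i; apply: msel.
have mS j B : @past_measurable _ _ _ _ T X t _ _ (fun w =>
    \sum_(i < u) (phi (s0 + i) w == j)%:R * sat (X (s0 + i)%N j w) B : R).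
  apply: measurable_sum => i; apply: measurable_funM; first exact: msel.
  apply: (measurableT_comp (measurable_sat B)).
  have it : (s0 + i < t)%N by rewrite tE ltn_add2l.
  apply: (@past_measurable_mono _ _ _ _ _ _ (s0 + i).+1) => //.
  by apply: past_measurable_reward; exact: ltn_trans it tT.
have mNm j m : @past_measurable _ _ _ _ T X t _ _ (fun w => pulls pi X s0 j u w == m).
  rewrite (_ : (fun w => _) = fun w => (pulls pi X s0 j u w)%:R == m%:R :> R); last first.
    by apply/funext => w; rewrite eqr_nat.
  by apply: measurable_fun_eqr; [exact: mN|exact: measurable_cst].
pose hl w := drop s0 (history pi X w t).
have midx j : @past_measurable _ _ _ _ T X t _ _ (fun w => rmoss_index a zeta H (hl w) j).
  (* The truncation level depends on the random pull count; splitting along its possible values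
     makes it constant in each summand. *)
  rewrite (_ : (fun w => _) = fun w => \sum_(m < u.+1)
      if pulls pi X s0 j u w == m then
      (\sum_(i < u) (phi (s0 + i) w == j)%:R * sat (X (s0 + i)%N j w) (Bm K a H m)) / m%:R +
      (1 + zeta) * cm R K H m else 0); last first.
    apply/funext => w; rewrite /rmoss_index /trunc_mean /hl tE npulls_drop.
    rewrite (sum_drop pi X s0 j u w (fun x => sat x _)).
    have Nu : (pulls pi X s0 j u w < u.+1)%N by rewrite ltnS pulls_le.
    rewrite (bigD1 (Ordinal Nu))//= eqxx [X in _ = _ + X]big1 ?addr0// => m mN'.
    by case: eqP => // e; case/eqP: mN'; apply/val_inj.
  apply: measurable_sum => m; apply: measurable_fun_ifT => //; first exact: mNm.
  by apply: measurable_funD => //; apply: measurable_funM => //; exact: mS.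
rewrite (_ : (fun w => _) = fun w => choose [ffun x => match x with
    | inl j => pulls pi X s0 j u w == 0%N
    | inr ij => rmoss_index a zeta H (hl w) ij.1 <= rmoss_index a zeta H (hl w) ij.2
    end] == k); last first.
  apply/funext => w; rewrite {1}tE selected_epoch// robust_mossE; congr (choose _ == k).
  by apply/ffunP => -[j|ij]; rewrite !ffunE ?npulls_drop// /hl tE.
apply: (@measurable_finite_bool _ (past_type T X t) _ (fun x w => match x with
    | inl j => pulls pi X s0 j u w == 0%N
    | inr ij => rmoss_index a zeta H (hl w) ij.1 <= rmoss_index a zeta H (hl w) ij.2
    end) (fun g => choose g == k)).
by move=> [j|ij]; [exact: mNm|apply: measurable_fun_ler; exact: midx].
Qed.

End Adaptedness.

(** * Linear inequalities behind the deviation and gap bounds *)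

Section LinearArithmetic.
Context {R : realType}.

Lemma lower_linear (m e x p q : R) :
  -1 * m - p <= e + (x - q) -> p <= q -> - m <= e + x.
Proof. lra. Qed.

Lemma upper_linear (m p q e : R) : m - p <= q -> m <= e + (q - (e - p)).
Proof. lra. Qed.

(** The suffix [s] marks the comparator and [1] the selected arm: truncated mean [t], width [c],
    averaged noise [m], initial mean [mu]; [v] is the drift. In the bonus [(1 + z) * cs], [cs] pays
    for the bias of the comparator and [z * cs] for its noise. *)
Lemma gap_linear (ts t1 cs c1 ms m1 mus mu1 e r ls un g x z v : R) :
  ts + (1 + z) * cs <= t1 + (1 + z) * c1 -> t1 - m1 - mu1 <= c1 + v ->
  - (cs + v) <= ts - ms - mus -> m1 <= e + r -> - ms <= z * cs + ls -> ls <= un ->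
  g <= mus + v - (mu1 - v) -> c1 <= e + x -> z * c1 <= z * e + z * x ->
  g <= 4 * v + un + (3 + z) * e + ((2 + z) * x + r).
Proof. lra. Qed.

End LinearArithmetic.

Lemma integral_affine_le {R : realType} {d} {Omega : measurableType d}
    (P : probability Omega R) (I : finType) (c : R) (wt b : I -> R)
    (Y : I -> Omega -> R) :
  0 <= c -> (forall i, 0 <= wt i) -> (forall i, measurable_fun setT (Y i)) ->
  (forall i w, 0 <= Y i w) -> (forall i, (\int[P]_w (Y i w)%:E <= (b i)%:E)%E) ->
  (\int[P]_w (c + \sum_i wt i * Y i w)%:E <= (c + \sum_i wt i * b i)%:E)%E.
Proof.
move=> c0 wt0 mY Y0 Yb.
have mwY i : measurable_fun setT (fun w => wt i * Y i w) by exact: measurable_funM.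
under eq_integral do rewrite EFinD -sumEFin.
rewrite ge0_integralD//; last 2 first.
- by move=> w _; apply: sume_ge0 => i _; rewrite lee_fin mulr_ge0.
- by apply: emeasurable_sum => i; apply/measurable_EFinP.
rewrite integral_cst//= probability_setT mule1 EFinD; apply: leeD => //.
rewrite ge0_integral_sum//; last 2 first.
- by move=> i; apply/measurable_EFinP.
- by move=> i w _; rewrite lee_fin mulr_ge0.
rewrite -sumEFin; apply: lee_sum => i _.
under eq_integral do rewrite EFinM.
rewrite ge0_integralZl_EFin//; last 2 first.
- by move=> w _; rewrite lee_fin.
- exact/measurable_EFinP.
by rewrite EFinM lee_wpmul2l ?lee_fin.
Qed.

(** * Means and gaps under the second moment bound *)

Section Means.
Context {R : realType}.
Variables (K T : nat) (f : nat -> 'I_K -> probability R R).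
Hypothesis second_moment : second_moment_le1 T f.

Lemma mean_of_le1 t k : (t < T)%N -> `|mean_of f t k| <= 1.
Proof. by move=> tT; exact: mean_norm_le1 (second_moment k tT). Qed.

Lemma gap_ge0 t k : 0 <= gap f t k.
Proof. by rewrite subr_ge0 bigmax_ge_id. Qed.

Lemma gap_le t k b : (forall j, mean_of f t j <= b) -> gap f t k <= b - mean_of f t k.
Proof. by move=> mb; rewrite lerD2r bigmax_le. Qed.

Lemma gap_le2 t k : (t < T)%N -> gap f t k <= 2.
Proof.
move=> tT; apply: le_trans (gap_le k (_ : forall j, mean_of f t j <= 1)) _.
  by move=> j; have := mean_of_le1 j tT; rewrite ler_norml => /andP[].
by have := mean_of_le1 k tT; rewrite ler_norml => /andP[+ _]; lra.
Qed.

End Means.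

(** * Regret within one epoch *)

Section Epoch.
Context {R : realType} {d : measure_display} {Omega : measurableType d}.
Variable P : probability Omega R.
Variables (K T H : nat) (k0 : 'I_K) (a zeta : R).
Variables (f : nat -> 'I_K -> probability R R) (X : nat -> 'I_K -> Omega -> R).
Hypotheses (a1 : 1 < a) (zeta0 : 0 < zeta).
Hypothesis psi_ge : psi (2 * zeta / a) >= 2 * a / zeta.
Hypotheses (K0 : (0 < K)%N) (H0 : (0 < H)%N) (KH : (K <= H)%N).
Hypothesis second_moment : second_moment_le1 T f.
Hypothesis law : forall (t : nat) (k : 'I_K) (A : set R), (t < T)%N ->
  measurable A -> P (X t k @^-1` A) = f t k A.
Hypothesis indep : mutually_independent P (fun i : 'I_T * 'I_K => X i.1 i.2).

Let pi : policy R K := rrmoss k0 a zeta H.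
Let phi := selected pi X.
Let phi_adapted : adapted T X phi.
Proof. exact: rrmoss_adapted. Qed.

Let a0 : 0 < a. Proof. exact: lt_trans a1. Qed.

Definition truncated_mean (t : nat) (k : 'I_K) (B : R) : R :=
  \int[f t k]_x sat x B.

(** [sg] is -1 for underestimation and 1 for overestimation. With [c = v / lam] the subtraction at
    each pull offsets the second-order term, which brings the exponential moment at rate [lam] down
    to at most 1. *)
Definition noise (k : 'I_K) (B sg c : R) (t : nat) (x : R) : R :=
  sg * (sat x B - truncated_mean t k B) - c.

Lemma measurable_noise k B sg c t : measurable_fun setT (noise k B sg c t).
Proof.
apply: measurable_funB => //; apply: measurable_funM => //.
by apply: measurable_funB => //; exact: measurable_sat.
Qed.

Lemma integral_law t k (g : R -> R) : (t < T)%N -> measurable_fun setT g ->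
  (forall x, 0 <= g x) ->
  (\int[P]_w (g (X t k w))%:E = \int[f t k]_x (g x)%:E)%E.
Proof.
move=> tT mg g0.
have mX : measurable_fun setT (X t k) by exact: indep.1 (Ordinal tT, k).
rewrite -(@eq_measure_integral _ _ _ _ (f t k) (pushforward P (X t k))).
  rewrite ge0_integral_pushforward//; first by apply/measurable_EFinP.
  by move=> x _; rewrite lee_fin.
by move=> A mA _; rewrite /= /pushforward law.
Qed.

Lemma noise_mgf_le1 k B lam v sg t : (t < T)%N -> 0 < B -> 0 < lam -> 0 <= v ->
    `|sg| = 1 ->
    (forall y, `|y| <= 2 * B -> expR (lam * y) <= 1 + lam * y + v * y ^+ 2) ->
  (\int[P]_w (expR (lam * noise k B sg (v / lam) t (X t k w)))%:E <= 1)%E.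
Proof.
move=> tT B0 lam0 v0 sg1 expB.
rewrite (@integral_law t k (fun x => expR (lam * noise k B sg (v / lam) t x)))//.
  apply: le_trans (truncated_mgf_le1 (second_moment k tT) B0 v0 sg1 expB).
  rewrite le_eqVlt; apply/orP; left; apply/eqP; apply: eq_integral => x _.
  by rewrite /noise mulrBr [lam * (v / lam)]mulrC divfK ?gt_eqF.
by apply: measurableT_comp => //; apply: measurable_funM => //; exact: measurable_noise.
Qed.

Variables (s0 L : nat).
Hypotheses (Hs0 : (H %| s0)%N) (LH : (L <= H)%N) (s0LT : (s0 + L <= T)%N).

(* [lower_excess k j] controls the underestimation of arm [k] at all the times when
   its truncation level is that of [h = a ^ j]. *)
Definition lower_excess (k : 'I_K) (j : nat) (w : Omega) : R :=
  let B := (width K H (a ^+ j))^-1 in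
  running_max X phi k s0
    (noise k B (-1) (lower_drift a zeta B / lower_rate a zeta B))
    (lower_start K H a zeta (a ^+ j)) L w - lower_start K H a zeta (a ^+ j).

(** Controls the overestimation of arm [k] when it has exactly [m] earlier pulls; fixing [m] makes
    the truncation level and the threshold deterministic. *)
Definition upper_excess (k : 'I_K) (m : nat) (w : Omega) : R :=
  running_max X phi k s0
    (noise k (Bm K a H m) 1 (upper_drift a m / upper_rate a m))
    (upper_start K H a m) L w - upper_start K H a m.

Lemma lower_excess_ge0 k j w : 0 <= lower_excess k j w.
Proof. by rewrite subr_ge0 running_max_ge_start. Qed.

Lemma upper_excess_ge0 k m w : 0 <= upper_excess k m w.
Proof. by rewrite subr_ge0 running_max_ge_start. Qed.

Lemma measurable_lower_excess k j : measurable_fun setT (lower_excess k j).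
Proof.
apply: measurable_funB => //.
by apply: (measurable_running_max indep phi_adapted) => // s; exact: measurable_noise.
Qed.

Lemma measurable_upper_excess k m : measurable_fun setT (upper_excess k m).
Proof.
apply: measurable_funB => //.
by apply: (measurable_running_max indep phi_adapted) => // s; exact: measurable_noise.
Qed.

Let u_gt0 : 0 < 2 * zeta / a.
Proof. by rewrite divr_gt0// mulr_gt0. Qed.

Let l_gt0 : 0 < ln (1 + 2 * zeta / a).
Proof. by rewrite ln_gt0// ltrDl. Qed.

Let lower_drift_ge0 B : 0 <= lower_drift a zeta B.
Proof.
apply: divr_ge0; last by rewrite mulr_ge0// sqr_ge0.
rewrite subr_ge0.
by apply: le_ln1Dx; apply: lt_trans u_gt0; rewrite ltrN10.
Qed.

Let lower_rate_gt0 B : 0 < B -> 0 < lower_rate a zeta B.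
Proof. by move=> B0; rewrite /lower_rate divr_gt0// mulr_gt0. Qed.

Lemma integral_lower_excess k j :
  (\int[P]_w (lower_excess k j w)%:E <=
   ((lower_rate a zeta (width K H (a ^+ j))^-1)^-1 *
    expR (- (lower_rate a zeta (width K H (a ^+ j))^-1 *
      lower_start K H a zeta (a ^+ j))))%:E)%E.
Proof.
have B0 : 0 < (width K H (a ^+ j))^-1 by rewrite invr_gt0 width_gt0// exprn_gt0.
apply: (integral_running_max indep phi_adapted) => //.
- by move=> s; exact: measurable_noise.
- exact: lower_rate_gt0.
- move=> s /andP[_ sT]; apply: noise_mgf_le1 => //.
  + exact: lower_rate_gt0.
  + by rewrite normrN1.
  + move=> y yB; apply: bennett_mgf => //.
    by rewrite lnK// posrE addr_gt0.
Qed.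

Let upper_rate_gt0 m : (0 < m)%N -> 0 < upper_rate a m.
Proof.
by move=> m0; rewrite /upper_rate invr_gt0 mulr_gt0// sqrtr_gt0 mulr_gt0// ltr0n.
Qed.

Lemma integral_upper_excess k m : (0 < m)%N ->
  (\int[P]_w (upper_excess k m w)%:E <=
   ((upper_rate a m)^-1 * expR (- (upper_rate a m * upper_start K H a m)))%:E)%E.
Proof.
move=> m0; apply: (integral_running_max indep phi_adapted) => //.
- by move=> s; exact: measurable_noise.
- exact: upper_rate_gt0.
- move=> s /andP[_ sT]; apply: noise_mgf_le1 => //.
  + exact: Bm_gt0.
  + exact: upper_rate_gt0.
  + by rewrite /upper_drift mulr_ge0// sqr_ge0.
  + by rewrite normr1.
  + move=> y yB; rewrite /upper_drift -mulrA -exprMn; apply: expR_quadratic_le.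
    have s1 : 0 < Num.sqrt (a * m%:R) by rewrite sqrtr_gt0 mulr_gt0// ltr0n.
    rewrite normrM gtr0_norm ?upper_rate_gt0// /upper_rate.
    rewrite mulrC ler_pdivrMr ?mulr_gt0//; apply: le_trans yB _.
    by have := Bm_le K H a1 m0; lra.
Qed.

Let N k u w := pulls pi X s0 k u w.

Let M k B u w : R := \sum_(i < u) (phi (s0 + i) w == k)%:R *
  (sat (X (s0 + i)%N k w) B - truncated_mean (s0 + i) k B).

Let sampled_sum_noise k B sg c u w :
  sampled_sum X phi k s0 (noise k B sg c) u w = sg * M k B u w - c * (N k u w)%:R.
Proof.
rewrite /sampled_sum /M /N /pulls natr_sum !mulr_sumr -sumrB.
by apply: eq_bigr => i _; rewrite /noise -/phi; ring.
Qed.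

Let pulls_gt0_time k u w : (0 < N k u w)%N -> (0 < u)%N.
Proof. by move=> N0; apply: leq_trans N0 (pulls_le _ _ _ _ _ _). Qed.

(** At level [h] the pull count [n] lies between [h / a] and [h]: the upper bound covers the
    compensator, the lower one allows division by [n], and [width h] is at most the width at [n]. *)
Lemma lower_deviation k u w : (u <= L)%N -> (0 < N k u w)%N ->
  - (M k (Bm K a H (N k u w)) u w / (N k u w)%:R) <=
  zeta * cm R K H (N k u w) +
  a / a ^+ level a (N k u w) * lower_excess k (level a (N k u w)) w.
Proof.
move=> uL N0; set n := N k u w in N0 *.
have n0 : (0 : R) < n%:R by rewrite ltr0n.
have hE := hfunE a1 N0.
have hn := hfun_ge a1 N0; have han := hfun_le a1 N0; have h0 := hfun_gt0 a1 N0.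
rewrite BmE// cmE /lower_excess -hE; set h := hfun a n in hn han h0 *.
have w0 : 0 < width K H h by rewrite width_gt0.
set B := (width K H h)^-1.
have B0 : 0 < B by rewrite invr_gt0.
set c := lower_drift a zeta B / lower_rate a zeta B.
have c0 : 0 <= c by rewrite divr_ge0// ltW// lower_rate_gt0.
have := @running_max_ge _ _ _ _ X phi k s0 (noise k B (-1) c) (lower_start K H a zeta h)
  u L w.
rewrite (pulls_gt0_time N0) uL => /(_ isT).
rewrite sampled_sum_noise -/n; set Q := running_max _ _ _ _ _ _ _ _.
have startE : lower_start K H a zeta h = h * zeta * width K H h / a - c * h.
  by rewrite /lower_start -/B /c; congr (_ - _); ring.
have EQ : 0 <= Q - lower_start K H a zeta h by rewrite subr_ge0 running_max_ge_start.
move: EQ; set E := Q - _ => EQ.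
have -> : Q = E + (h * zeta * width K H h / a - c * h) by rewrite -startE /E; ring.
move=> MQ.
have cn : c * n%:R <= c * h by rewrite ler_wpM2l.
have {}MQ := lower_linear MQ cn.
have rhs0 : 0 <= E + h * zeta * width K H h / a.
  by rewrite addr_ge0// !mulr_ge0 ?invr_ge0// ltW.
rewrite -mulNr; apply: (@le_trans _ _ ((E + h * zeta * width K H h / a) * (a / h))).
  apply: le_trans (_ : (E + h * zeta * width K H h / a) / n%:R <= _).
    by rewrite ler_pM2r// invr_gt0.
  by rewrite ler_wpM2l// -invf_div lef_pV2 ?posrE ?divr_gt0// ler_pdivrMr// mulrC.
rewrite [leLHS](_ : _ = zeta * width K H h + a / h * E); last first.
  by field; rewrite !gt_eqF.
by rewrite lerD2r ler_pM2l// width_le.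
Qed.

Lemma upper_deviation k u w : (u <= L)%N -> (0 < N k u w)%N ->
  M k (Bm K a H (N k u w)) u w / (N k u w)%:R <=
  eps K H + (N k u w)%:R^-1 * upper_excess k (N k u w) w.
Proof.
move=> uL N0; set n := N k u w in N0 *.
have n0 : (0 : R) < n%:R by rewrite ltr0n.
rewrite /upper_excess; set B := Bm K a H n.
set c := upper_drift a n / upper_rate a n.
have := @running_max_ge _ _ _ _ X phi k s0 (noise k B 1 c) (upper_start K H a n) u L w.
rewrite (pulls_gt0_time N0) uL => /(_ isT).
rewrite sampled_sum_noise -/n mul1r; set Q := running_max _ _ _ _ _ _ _ _.
have -> : upper_start K H a n = n%:R * eps K H - c * n%:R.
  by rewrite /upper_start /c; congr (_ - _); ring.
move=> MQ.
rewrite ler_pdivrMr// mulrDl mulrAC mulVf ?gt_eqF// mul1r.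
by rewrite (mulrC (eps _ _)); exact: upper_linear MQ.
Qed.

Variable Ve : R.
Hypothesis drift : forall u k, (u < L)%N ->
  `|mean_of f (s0 + u) k - mean_of f s0 k| <= Ve.

(** [M] centers each reward at its own truncated mean, so two errors remain per pull: the truncation
    bias, at most one width, and the drift since the start of the epoch. *)
Lemma trunc_mean_dev k u w : (u < L)%N -> (0 < N k u w)%N ->
  `|trunc_mean a H (drop s0 (history pi X w (s0 + u))) k -
    M k (Bm K a H (N k u w)) u w / (N k u w)%:R - mean_of f s0 k| <=
  cm R K H (N k u w) + Ve.
Proof.
move=> uL N0; rewrite /trunc_mean npulls_drop -/(N k u w).
rewrite (sum_drop pi X s0 k u w (fun x => sat x _)).
set n := N k u w in N0 *; set B := Bm K a H n.
have n0 : (0 : R) < n%:R by rewrite ltr0n.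
rewrite [X in `|X|](_ : _ = (\sum_(i < u) (phi (s0 + i) w == k)%:R *
    (truncated_mean (s0 + i) k B - mean_of f s0 k)) / n%:R); last first.
  apply: (mulIf (lt0r_neq0 n0)); rewrite mulrBl mulrBl !divfK ?gt_eqF//.
  rewrite {1}/n /N /pulls natr_sum mulr_sumr -!sumrB.
  by apply: eq_bigr => i _; rewrite -/phi; ring.
rewrite normrM normfV (gtr0_norm n0) ler_pdivrMr//.
apply: le_trans (ler_norm_sum _ _ _) _.
rewrite {2}/n /N /pulls natr_sum mulr_sumr; apply: ler_sum => i _.
rewrite normrM -/phi; case: eqP => _; last by rewrite normr0 mul0r mulr0.
rewrite normr1 mul1r mulr1.
have iL : (i < L)%N by exact: ltn_trans uL.
rewrite -(subrKA (mean_of f (s0 + i) k)).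
apply: le_trans (ler_normD _ _) _; apply: lerD; last exact: drift.
apply: le_trans (Bm_inv_le K0 H0 a1 N0).
apply: truncated_mean_bias; last exact: Bm_gt0.
by apply: second_moment; apply: leq_trans s0LT; rewrite ltn_add2l.
Qed.

(** A comparator fixed for the whole epoch, so that the underestimation of only one arm enters. *)
Let kstar := Order.arg_max k0 xpredT (mean_of f s0).

Let kstarP k : mean_of f s0 k <= mean_of f s0 kstar.
Proof. by rewrite /kstar; case: arg_maxP => // i _; apply. Qed.

Definition top_level : nat := \max_(m < H.+1) level a m.

(** The sum over levels stands in for the maximum, as all terms are nonnegative; levels are at least
    1, hence the shift [j.+1]. *)
Definition underestimation (w : Omega) : R :=
  \sum_(j < top_level) a / a ^+ j.+1 * lower_excess kstar j.+1 w.

(** Cost of a pull beyond the terms common to all rounds. At the first pull of an arm, [m = 0],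
    there is no estimate and the trivial gap bound 2 is charged. *)
Definition pull_cost (w : Omega) (k : 'I_K) (m : nat) : R :=
  if m == 0%N then 2 else
  (2 + zeta) * Num.max 0 (cm R K H m - eps K H) + m%:R^-1 * upper_excess k m w.

Let level_term_le u w : (u <= L)%N ->
  a / a ^+ level a (N kstar u w) * lower_excess kstar (level a (N kstar u w)) w <=
  underestimation w.
Proof.
move=> uL; set n := N kstar u w.
have nH : (n < H.+1)%N.
  by rewrite ltnS; apply: leq_trans (pulls_le _ _ _ _ _ _) _; exact: leq_trans uL LH.
have lev : (level a n <= top_level)%N by exact: (leq_bigmax (Ordinal nH)).
have lev' : ((level a n).-1 < top_level)%N by [].
rewrite /underestimation (bigD1 (Ordinal lev'))//= lerDl sumr_ge0// => j _.
by rewrite mulr_ge0 ?lower_excess_ge0// divr_ge0 ?exprn_ge0// ltW.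
Qed.

Lemma gap_le_cost u w : (u < L)%N ->
  gap f (s0 + u) (phi (s0 + u) w) <=
  4 * Ve + underestimation w + (3 + zeta) * eps K H +
  pull_cost w (phi (s0 + u) w) (N (phi (s0 + u) w) u w).
Proof.
move=> uL.
have uH : (u < H)%N by exact: leq_trans uL LH.
have tT : (s0 + u < T)%N by apply: leq_trans s0LT; rewrite ltn_add2l.
have Ve0 : 0 <= Ve by exact: le_trans (normr_ge0 _) (drift k0 uL).
have under0 : 0 <= underestimation w.
  apply: sumr_ge0 => j _.
  by rewrite mulr_ge0 ?lower_excess_ge0// divr_ge0 ?exprn_ge0// ltW.
have e0 : 0 < eps K H :> R by exact: eps_gt0.
have ze0 : 0 <= (3 + zeta) * eps K H by rewrite mulr_ge0// ?addr_ge0// ltW.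
rewrite /pull_cost; case: eqP => [_|/eqP].
  apply: le_trans (gap_le2 second_moment (phi (s0 + u) w) tT) _.
  by rewrite lerDr !addr_ge0// mulr_ge0.
rewrite -lt0n; set k1 := phi (s0 + u) w => N1.
(* If the selected arm has been pulled before, the initial round is over: an unpulled arm would have
   been picked first. *)
have [allN idx_max] : (forall k, 0 < N k u w)%N /\
    forall k, rmoss_index a zeta H (drop s0 (history pi X w (s0 + u))) k <=
      rmoss_index a zeta H (drop s0 (history pi X w (s0 + u))) k1.
  move: N1; rewrite /k1 /phi selected_epoch// -/pi /robust_moss.
  case: pickP => [k /eqP|noneN _].
    by rewrite npulls_drop -/(N k u w) => ->; rewrite ltnn.
  split=> [k|k].
    by rewrite lt0n; have := noneN k; rewrite npulls_drop => ->.
  by case: arg_maxP => // i _; apply.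
have Ns := allN kstar.
have := idx_max kstar; rewrite /rmoss_index !npulls_drop -/(N _ _ _) -/(N _ _ _).
have := trunc_mean_dev uL Ns; have := trunc_mean_dev uL N1.
have := lower_deviation (ltnW uL) Ns; have := upper_deviation (ltnW uL) N1.
have := level_term_le w (ltnW uL).
rewrite !ler_norml => lev up low /andP[_ dev1] /andP[devs _] idx.
have gapb : gap f (s0 + u) k1 <= (mean_of f s0 kstar + Ve) - (mean_of f s0 k1 - Ve).
  apply: le_trans (gap_le k1 (_ : forall j, mean_of f (s0 + u) j <=
      mean_of f s0 kstar + Ve)) _.
    move=> j; have := drift j uL; rewrite ler_norml => /andP[_].
    by rewrite lerBlDl => mj; apply: le_trans mj _; rewrite lerD2r kstarP.
  have := drift k1 uL; rewrite ler_norml lerBrDl => /andP[m1 _].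
  by rewrite lerD2l lerN2.
have cmax : cm R K H (N k1 u w) <= eps K H +
    Num.max 0 (cm R K H (N k1 u w) - eps K H).
  by rewrite -lerBlDl le_max lexx orbT.
have cmaxz : zeta * cm R K H (N k1 u w) <= zeta * eps K H +
    zeta * Num.max 0 (cm R K H (N k1 u w) - eps K H).
  by rewrite -mulrDr ler_pM2l.
exact: gap_linear idx dev1 devs up low lev gapb cmax cmaxz.
Qed.

Lemma measurable_gap t : (t < T)%N ->
  measurable_fun setT (fun w => gap f t (phi t w)).
Proof.
move=> tT; rewrite (_ : (fun w => _) =
    fun w => \sum_k (phi t w == k)%:R * gap f t k); last first.
  apply/funext => w; rewrite (bigD1 (phi t w))//= eqxx mul1r big1 ?addr0// => k.
  by rewrite eq_sym => /negbTE ->; rewrite mul0r.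
apply: measurable_sum => k; apply: measurable_funM => //.
exact: (past_measurableW indep (past_measurable_selected phi_adapted k tT)).
Qed.

Hypothesis Ve0 : 0 <= Ve.

Lemma epoch_gap_le w : \sum_(u < L) gap f (s0 + u) (phi (s0 + u) w) <=
  H%:R * (4 * Ve + underestimation w + (3 + zeta) * eps K H) +
  \sum_k (2 + \sum_(m < L) pull_cost w k m.+1).
Proof.
have under0 : 0 <= underestimation w.
  apply: sumr_ge0 => j _.
  by rewrite mulr_ge0 ?lower_excess_ge0// divr_ge0 ?exprn_ge0// ltW.
have e0 : 0 < eps K H :> R by exact: eps_gt0.
have cost0 k m : 0 <= pull_cost w k m.
  rewrite /pull_cost; case: eqP => // _.
  rewrite addr_ge0// mulr_ge0 ?upper_excess_ge0 ?invr_ge0//.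
    by rewrite addr_ge0// ltW.
  by rewrite le_max lexx.
have base0 : 0 <= 4 * Ve + underestimation w + (3 + zeta) * eps K H.
  by rewrite !addr_ge0 ?mulr_ge0 ?addr_ge0// ltW.
apply: (@le_trans _ _ (\sum_(u < L) (4 * Ve + underestimation w +
    (3 + zeta) * eps K H + pull_cost w (phi (s0 + u) w) (N (phi (s0 + u) w) u w)))).
  by apply: ler_sum => u _; exact: gap_le_cost.
rewrite big_split /=; apply: lerD.
  by rewrite sumr_const card_ord -[leLHS]mulr_natl ler_wpM2r// ler_nat.
rewrite (sum_selected_pulls pi X s0 L w (pull_cost w)).
apply: ler_sum => k _.
rewrite -(big_mkord xpredT (pull_cost w k)) /=.
(* The constant 2 is the cost at [m = 0]; the enlarged range frees the bound from the random pull
   counts. *)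
have -> : 2 + \sum_(m < L) pull_cost w k m.+1 = \sum_(0 <= m < L.+1) pull_cost w k m.
  by rewrite big_mkord big_ord_recl.
have NL : (pulls pi X s0 k L w <= L.+1)%N.
  by apply: leqW; exact: pulls_le.
by rewrite [leRHS](big_cat_nat (leq0n _) NL)//= lerDl sumr_ge0.
Qed.

Lemma sqrtr_exprn (x : R) n : 0 <= x -> Num.sqrt (x ^+ n) = Num.sqrt x ^+ n.
Proof.
move=> x0; elim: n => [|n IHn]; first by rewrite !expr0 sqrtr1.
by rewrite !exprS sqrtrM// IHn.
Qed.

(** In order: the [eps] charged at every round, the first pulls, the excess widths, the
    underestimation of the comparator, the overestimation of the selected arms. *)
Definition regret_const : R :=
  (3 + zeta) + 2 + 8 * (2 + zeta) +
  2 * a / ln (1 + 2 * zeta / a) * (2 * (Num.sqrt a + 1) / (Num.sqrt a - 1)) +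
  4 * Num.sqrt a * expR 1 * (2 * (4 * Num.sqrt a)).

(** At [h = a ^+ j.+1] the quantity [eps * sqrt h] runs through a geometric progression of ratio
    [sqrt a], so [sum_geometric_min_le] applies. *)
Lemma sum_lower_bounds n :
  \sum_(j < n) a / a ^+ j.+1 * ((lower_rate a zeta (width K H (a ^+ j.+1))^-1)^-1 *
    expR (- (lower_rate a zeta (width K H (a ^+ j.+1))^-1 *
      lower_start K H a zeta (a ^+ j.+1)))) <=
  2 * a / ln (1 + 2 * zeta / a) * (2 * (Num.sqrt a + 1) / (Num.sqrt a - 1)) * eps K H.
Proof.
have e0 : 0 < eps K H :> R by exact: eps_gt0.
have s1 : 1 < Num.sqrt a by rewrite -[ltLHS]sqrtr1 ltr_sqrt.
apply: (@le_trans _ _ (\sum_(j < n) 2 * a / ln (1 + 2 * zeta / a) * eps K H *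
    Num.min (eps K H * Num.sqrt a * Num.sqrt a ^+ j)
      (eps K H * Num.sqrt a * Num.sqrt a ^+ j)^-1)).
  apply: ler_sum => j _.
  have aj : 0 < a ^+ j.+1 by rewrite exprn_gt0.
  apply: le_trans (lower_level_bound K0 H0 a1 zeta0 psi_ge aj) _.
  by rewrite (sqrtr_exprn _ (ltW a0)) exprS mulrA.
rewrite -mulr_sumr [leRHS]mulrAC.
apply: ler_wpM2l; first by rewrite mulr_ge0 ?divr_ge0 ?mulr_ge0// ltW.
by apply: sum_geometric_min_le => //; rewrite mulr_gt0// (lt_trans ltr01).
Qed.

Lemma sum_upper_bounds n :
  \sum_(m < n) m.+1%:R^-1 * ((upper_rate a m.+1)^-1 *
    expR (- (upper_rate a m.+1 * upper_start K H a m.+1))) <=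
  4 * Num.sqrt a * expR 1 * (2 * (4 * Num.sqrt a)) / eps K H.
Proof.
have e0 : 0 < eps K H :> R by exact: eps_gt0.
have s0' : 0 < Num.sqrt a by rewrite sqrtr_gt0.
apply: (@le_trans _ _ (\sum_(m < n) 4 * Num.sqrt a * expR 1 *
    ((Num.sqrt m.+1%:R)^-1 * expR (- (eps K H / (4 * Num.sqrt a) * Num.sqrt m.+1%:R))))).
  by apply: ler_sum => m _; exact: upper_level_bound.
rewrite -mulr_sumr -[leRHS]mulrA; apply: ler_wpM2l.
  by rewrite !mulr_ge0 ?expR_ge0// ltW.
have c0 : 0 < eps K H / (4 * Num.sqrt a) by rewrite divr_gt0// mulr_gt0.
apply: le_trans (sum_sqrt_expR_le _ c0) _.
rewrite le_eqVlt; apply/orP; left; apply/eqP.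
by field; rewrite !gt_eqF.
Qed.

Lemma integral_epoch_gap :
  (\int[P]_w (\sum_(u < L) gap f (s0 + u) (phi (s0 + u) w))%:E <=
   (4 * H%:R * Ve + regret_const * Num.sqrt (K%:R * H%:R))%:E)%E.
Proof.
have e0 : 0 < eps K H :> R by exact: eps_gt0.
have H0' : (0 : R) < H%:R by rewrite ltr0n.
have K0' : (0 : R) < K%:R by rewrite ltr0n.
pose S := \sum_(m < L) Num.max 0 (cm R K H m.+1 - eps K H).
have S0 : 0 <= S by apply: sumr_ge0 => m _; rewrite le_max lexx.
pose c := H%:R * (4 * Ve + (3 + zeta) * eps K H) + K%:R * (2 + (2 + zeta) * S).
(* One index type for all random terms: [inl] for the levels of [kstar], [inr] for the pairs of an
   arm and a pull count; [c] collects the deterministic rest. *)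
pose wt (i : 'I_top_level + 'I_K * 'I_L) : R := match i with
  | inl j => H%:R * (a / a ^+ j.+1) | inr km => (km.2.+1)%:R^-1 end.
pose Y (i : 'I_top_level + 'I_K * 'I_L) := match i with
  | inl j => lower_excess kstar j.+1 | inr km => upper_excess km.1 km.2.+1 end.
pose b (i : 'I_top_level + 'I_K * 'I_L) : R := match i with
  | inl j => (lower_rate a zeta (width K H (a ^+ j.+1))^-1)^-1 *
      expR (- (lower_rate a zeta (width K H (a ^+ j.+1))^-1 *
        lower_start K H a zeta (a ^+ j.+1)))
  | inr km => (upper_rate a km.2.+1)^-1 *
      expR (- (upper_rate a km.2.+1 * upper_start K H a km.2.+1)) end.
have c0 : 0 <= c.
  by rewrite addr_ge0// mulr_ge0 ?addr_ge0 ?mulr_ge0 ?addr_ge0// ltW.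
have wt0 i : 0 <= wt i.
  by case: i => [j|km]; rewrite /wt ?invr_ge0 ?mulr_ge0 ?invr_ge0 ?exprn_ge0// ltW.
have mY i : measurable_fun setT (Y i).
  case: i => [j|km]; [exact: measurable_lower_excess|exact: measurable_upper_excess].
have Y0 i w : 0 <= Y i w.
  case: i => [j|km]; [exact: lower_excess_ge0|exact: upper_excess_ge0].
have Yb i : (\int[P]_w (Y i w)%:E <= (b i)%:E)%E.
  case: i => [j|km]; [exact: integral_lower_excess|exact: integral_upper_excess].
apply: (@le_trans _ _ (\int[P]_w (c + \sum_i wt i * Y i w)%:E)%E).
  apply: ge0_le_integral => //.
  - by move=> w _; rewrite lee_fin; apply: sumr_ge0 => u _; exact: gap_ge0.
  - apply/measurable_EFinP; apply: measurable_sum => u; apply: measurable_gap.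
    by apply: leq_trans s0LT; rewrite ltn_add2l.
  - apply/measurable_EFinP; apply: measurable_funD => //.
    by apply: measurable_sum => i; exact: measurable_funM.
  - move=> w _; rewrite lee_fin; apply: le_trans (epoch_gap_le w) _.
    rewrite le_eqVlt; apply/orP; left; apply/eqP.
    rewrite big_sumType /= /c.
    have -> : \sum_k (2 + \sum_(m < L) pull_cost w k m.+1) =
        K%:R * (2 + (2 + zeta) * S) +
        \sum_(i : 'I_K * 'I_L) (i.2.+1)%:R^-1 * upper_excess i.1 i.2.+1 w.
      rewrite -(pair_bigA _ (fun k (m : 'I_L) => (m.+1)%:R^-1 * upper_excess k m.+1 w)) /=.
      rewrite (_ : K%:R * _ = \sum_(k < K) (2 + (2 + zeta) * S)); last first.
        by rewrite sumr_const card_ord mulr_natl.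
      rewrite -big_split /=.
      apply: eq_bigr => k _; rewrite -[RHS]addrA.
      suff -> : \sum_(m < L) pull_cost w k m.+1 = (2 + zeta) * S +
        \sum_(m < L) (m.+1)%:R^-1 * upper_excess k m.+1 w by [].
      by rewrite /S mulr_sumr -big_split /=; apply: eq_bigr.
    have -> : \sum_(j < top_level) H%:R * (a / a ^+ j.+1) * lower_excess kstar j.+1 w =
        H%:R * underestimation w.
      by rewrite /underestimation mulr_sumr; apply: eq_bigr => j _; rewrite [RHS]mulrA.
    by ring.
apply: le_trans (integral_affine_le c0 wt0 mY Y0 Yb) _.
rewrite lee_fin big_sumType /= /c.
rewrite -(pair_bigA _ (fun (k : 'I_K) (m : 'I_L) => (m.+1)%:R^-1 *
  ((upper_rate a m.+1)^-1 * expR (- (upper_rate a m.+1 * upper_start K H a m.+1))))) /=.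
rewrite sumr_const card_ord.
have := sum_upper_bounds L; move: (\sum_(m < L) _^-1 * _) => SU leU.
rewrite -[SU *+ K]mulr_natl.
have -> : \sum_(j < top_level) H%:R * (a / a ^+ j.+1) *
    ((lower_rate a zeta (width K H (a ^+ j.+1))^-1)^-1 *
      expR (- (lower_rate a zeta (width K H (a ^+ j.+1))^-1 *
        lower_start K H a zeta (a ^+ j.+1)))) =
    H%:R * \sum_(j < top_level) (a / a ^+ j.+1 *
    ((lower_rate a zeta (width K H (a ^+ j.+1))^-1)^-1 *
      expR (- (lower_rate a zeta (width K H (a ^+ j.+1))^-1 *
        lower_start K H a zeta (a ^+ j.+1))))).
  by rewrite mulr_sumr; apply: eq_bigr => j _; rewrite [RHS]mulrA.
have := sum_lower_bounds top_level; move: (\sum_(j < top_level) _) => SL leL.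
have leS : S <= 8 / eps K H by exact: sum_width_excess_le.
set W := Num.sqrt (K%:R * H%:R).
(* The choice of [eps] equalizes the two scales: [H * eps] and [K / eps] are both [W]. *)
have HW : H%:R * eps K H = W.
  rewrite /W /eps (_ : K%:R * H%:R = H%:R ^+ 2 * (K%:R / H%:R)); last first.
    by field; rewrite gt_eqF.
  by rewrite [RHS]sqrtrM ?sqr_ge0// sqrtr_sqr ger0_norm// ltW.
have KW : K%:R / eps K H = W.
  apply: (mulIf (lt0r_neq0 e0)); rewrite divfK ?gt_eqF// -HW -mulrA -expr2.
  by rewrite /eps sqr_sqrtr ?divr_ge0// mulrC divfK ?gt_eqF.
(* [K <= H] gives [eps <= 1], which absorbs the cost of the first pulls. *)
have KleW : K%:R <= W.
  rewrite -KW -[leLHS]mulr1 ler_pM2l// -[leLHS]invr1 lef_pV2 ?posrE//.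
  by rewrite -[leRHS]sqrtr1 ler_wsqrtr// ler_pdivrMr// mul1r ler_nat.
rewrite /regret_const; move: leL leU.
set A := 2 * a / _ * _; set D := 4 * Num.sqrt a * _ * _ => leL leU.
have hL : H%:R * SL <= A * W.
  by rewrite -HW mulrCA ler_pM2l.
have hU : K%:R * SU <= D * W.
  by rewrite -KW mulrCA ler_pM2l.
have hS : K%:R * S <= 8 * W.
  by rewrite -KW mulrCA ler_pM2l.
have hS' : (2 + zeta) * (K%:R * S) <= (2 + zeta) * (8 * W).
  by rewrite ler_pM2l// addr_gt0.
rewrite [leLHS](_ : _ = 4 * H%:R * Ve + (3 + zeta) * (H%:R * eps K H) + 2 * K%:R +
  (2 + zeta) * (K%:R * S) + (H%:R * SL + K%:R * SU)); last by ring.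
rewrite HW [leRHS](_ : _ = 4 * H%:R * Ve + (3 + zeta) * W + 2 * W +
  (2 + zeta) * (8 * W) + (A * W + D * W)); last by ring.
apply: lerD; last exact: lerD hL hU.
apply: lerD; last exact: hS'.
by rewrite lerD2l ler_pM2l.
Qed.

End Epoch.

(** * Summation over the epochs *)

Lemma sum_epochs {V : nmodType} (F : nat -> V) (T H n : nat) :
  \sum_(e < n) \sum_(u < minn H (T - e * H)) F (e * H + u)%N =
  \sum_(t < minn T (n * H)) F t.
Proof.
elim: n => [|n IHn]; first by rewrite big_ord0 mul0n minn0 big_ord0.
have -> : minn T (n.+1 * H) = (minn T (n * H) + minn H (T - n * H))%N.
  by rewrite mulSn; lia.
rewrite big_ord_recr /= IHn big_split_ord /=; congr (_ + _).
(* If [T] is reached before epoch [n], truncated subtraction makes that epoch empty. *)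
have [Tn|nT] := leqP T (n * H).
  by rewrite (eqP (_ : T - n * H == 0)%N) ?subn_eq0// minn0 !big_ord0.
by apply: eq_bigr.
Qed.

Section Restarts.
Context {R : realType} {d : measure_display} {Omega : measurableType d}.
Variable P : probability Omega R.
Variables (K T H : nat) (k0 : 'I_K) (a zeta : R).
Variables (f : nat -> 'I_K -> probability R R) (X : nat -> 'I_K -> Omega -> R).
Hypotheses (a1 : 1 < a) (zeta0 : 0 < zeta).
Hypothesis psi_ge : psi (2 * zeta / a) >= 2 * a / zeta.
Hypotheses (K0 : (0 < K)%N) (H0 : (0 < H)%N).
Hypothesis second_moment : second_moment_le1 T f.
Hypothesis law : forall (t : nat) (k : 'I_K) (A : set R), (t < T)%N ->
  measurable A -> P (X t k @^-1` A) = f t k A.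
Hypothesis indep : mutually_independent P (fun i : 'I_T * 'I_K => X i.1 i.2).

Let phi := selected (rrmoss k0 a zeta H) X.

(** Cut off at [T.-1], so that the step leaving the horizon counts for nothing and epoch sums may
    run up to their last time. *)
Definition variation_at (t : nat) : R := if (t < T.-1)%N then
  \big[Num.max/0]_(k : 'I_K) `|mean_of f t.+1 k - mean_of f t k| else 0.

Lemma variation_at_ge0 t : 0 <= variation_at t.
Proof. by rewrite /variation_at; case: ifP => // _; exact: bigmax_ge_id. Qed.

Lemma sum_variation_at : \sum_(t < T) variation_at t = Defs.total_variation T f.
Proof.
rewrite /Defs.total_variation /variation_at; case: T => [|n]; first by rewrite !big_ord0.
rewrite big_ord_recr /= ltnn addr0.
by apply: eq_bigr => t _; rewrite ltn_ord.
Qed.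

Lemma mean_drift s0 L u k : (s0 + L <= T)%N -> (u < L)%N ->
  `|mean_of f (s0 + u) k - mean_of f s0 k| <= \sum_(i < L) variation_at (s0 + i).
Proof.
move=> sL uL.
apply: (@le_trans _ _ (\sum_(i < u) variation_at (s0 + i))); last first.
  rewrite -!(big_mkord xpredT (fun i => variation_at (s0 + i))).
  rewrite [leRHS](big_cat_nat (leq0n _) (ltnW uL))//= lerDl sumr_ge0// => i _.
  exact: variation_at_ge0.
elim: u uL => [|u IHu] uL; first by rewrite addn0 subrr normr0 big_ord0.
rewrite big_ord_recr /= (_ : _ - _ = (mean_of f (s0 + u) k - mean_of f s0 k) +
  (mean_of f (s0 + u.+1) k - mean_of f (s0 + u) k)); last by ring.
apply: le_trans (ler_normD _ _) _; apply: lerD; last first.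
  rewrite /variation_at ifT; last by lia.
  rewrite addnS; exact: (le_bigmax _ (fun k => `|mean_of f (s0 + u).+1 k - mean_of f (s0 + u) k|)).
by apply: IHu; exact: ltnW.
Qed.

(** The extra epoch in [(T %/ H).+1] is the last one, possibly short or empty. A step across a
    boundary is charged to the earlier epoch only, so the epoch variations add up to the total
    one. *)
Lemma regret_le_restarts (V : R) : (K <= H)%N -> Defs.total_variation T f <= V ->
  (regret P f X (rrmoss k0 a zeta H) T <=
   (4 * H%:R * V + (T %/ H).+1%:R * (regret_const a zeta * Num.sqrt (K%:R * H%:R)))%:E)%E.
Proof.
move=> KH TV; rewrite /regret.
pose L e := minn H (T - e * H).
have nT : minn T ((T %/ H).+1 * H) = T.
  by apply/minn_idPl/ltnW; rewrite ltn_ceil.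
have LT (e : 'I_(T %/ H).+1) : (e * H + L e <= T)%N.
  have : (e * H <= T)%N.
    by apply: leq_trans (leq_trunc_div T H); rewrite leq_mul2r -ltnS ltn_ord orbT.
  by rewrite /L; lia.
have mgap (e : 'I_(T %/ H).+1) : measurable_fun setT
    (fun w => \sum_(u < L e) gap f (e * H + u) (phi (e * H + u) w)).
  apply: measurable_sum => u; apply: (measurable_gap k0 a zeta f H0 indep).
  by apply: leq_trans (LT e); rewrite ltn_add2l.
have sumE w : \sum_(t < T) gap f t (phi t w) =
    \sum_(e < (T %/ H).+1) \sum_(u < L e) gap f (e * H + u) (phi (e * H + u) w).
  by rewrite (sum_epochs (fun t => gap f t (phi t w)) T H) nT.
rewrite (eq_integral (fun w => (\sum_(e < (T %/ H).+1)
    (\sum_(u < L e) gap f (e * H + u) (phi (e * H + u) w))%:E)%E)); last first.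
  by move=> w _; rewrite sumEFin -sumE.
rewrite ge0_integral_sum//; last 2 first.
- by move=> e; apply/measurable_EFinP; exact: mgap.
- by move=> e w _; rewrite lee_fin; apply: sumr_ge0 => u _; exact: gap_ge0.
apply: (@le_trans _ _ (\sum_(e < (T %/ H).+1)
    (4 * H%:R * (\sum_(u < L e) variation_at (e * H + u)) +
     regret_const a zeta * Num.sqrt (K%:R * H%:R))%:E)%E).
  apply: lee_sum => e _; apply: integral_epoch_gap => //.
  - exact: second_moment.
  - exact: law.
  - exact: indep.
  - exact: dvdn_mull.
  - exact: geq_minl.
  - by move=> u k uL; exact: mean_drift (LT e) uL.
  - by apply: sumr_ge0 => u _; exact: variation_at_ge0.
rewrite sumEFin lee_fin big_split /= sumr_const card_ord.
apply: lerD; last by rewrite [leRHS]mulr_natl.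
rewrite -mulr_sumr (sum_epochs variation_at) nT sum_variation_at.
by rewrite ler_wpM2l// mulr_ge0.
Qed.

(** Serves the regime [T <= K * V], where an epoch may be shorter than the number of arms. *)
Lemma regret_le_trivial : (regret P f X (rrmoss k0 a zeta H) T <= (2 * T%:R)%:E)%E.
Proof.
rewrite /regret; apply: (@le_trans _ _ (\int[P]_w (2 * T%:R)%:E)%E); last first.
  by rewrite integral_cst//= probability_setT mule1.
apply: ge0_le_integral => //.
- by move=> w _; rewrite lee_fin; apply: sumr_ge0 => t _; exact: gap_ge0.
- apply/measurable_EFinP; apply: measurable_sum => t.
  exact: (measurable_gap k0 a zeta f H0 indep).
- move=> w _; rewrite lee_fin mulr_natr -[T in leRHS]card_ord -sumr_const.
  by apply: ler_sum => t _; exact: (gap_le2 second_moment _ (ltn_ord t)).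
Qed.

End Restarts.

(** * Choice of the epoch length *)

Lemma regret_const_gt0 {R : realType} (a zeta : R) : 1 < a -> 0 < zeta ->
  0 < regret_const a zeta.
Proof.
move=> a1 zeta0.
have u0 : 0 < 2 * zeta / a by rewrite divr_gt0 ?mulr_gt0// (lt_trans ltr01).
have l0 : 0 < ln (1 + 2 * zeta / a) by rewrite ln_gt0// ltrDl.
have s1 : 1 < Num.sqrt a by rewrite -[ltLHS]sqrtr1 ltr_sqrt// (lt_trans ltr01).
have e0 := expR_gt0 (1 : R).
rewrite /regret_const !addr_gt0//.
- by rewrite mulr_gt0// addr_gt0.
- by rewrite !(mulr_gt0, divr_gt0, invr_gt0)//; lra.
- by rewrite !mulr_gt0//; lra.
Qed.

Theorem theorem4 (R : realType) (a zeta : R) :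
  1 < a -> 0 < zeta -> psi (2 * zeta / a) >= 2 * a / zeta ->
  exists C : R, 0 < C /\
  forall (K : nat) (HK : (0 < K)%N) (T : nat) (V : R),
    0 < V -> (epoch_length K T V <= T)%N ->
  forall f : nat -> 'I_K -> probability R R, env_class T V f ->
  forall (d : measure_display) (Omega : measurableType d)
         (P : probability Omega R) (X : nat -> 'I_K -> Omega -> R),
    (forall (t : nat) (k : 'I_K) (A : set R), (t < T)%N -> measurable A ->
        P (X t k @^-1` A) = f t k A) ->
    mutually_independent P (fun i : 'I_T * 'I_K => X i.1 i.2) ->
    (regret P f X (rrmoss (Ordinal HK) a zeta (epoch_length K T V)) T
      <= (C * (K%:R * V) `^ (1/3) * (T%:R) `^ (2/3))%:E)%E.
Proof.
move=> a1 zeta0 psi_ge; set c1 := regret_const a zeta.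
have c10 : 0 < c1 by exact: regret_const_gt0.
(* 8 comes from [4 * tau * V] with [tau <= 2 * q], and [2 * c1] from the bound [2 * T / tau] on the
   number of epochs. *)
exists (8 + 2 * c1); split; first by lra.
move=> K HK T V V0 tauT f [second_moment TV] d Omega P X law indep.
have [T0|T0] := posnP T.
  subst T; rewrite /regret (eq_integral (cst 0%E)) ?integral0; last first.
    by move=> w _; rewrite big_ord0.
  by rewrite lee_fin !mulr_ge0 ?powR_ge0//; lra.
have cube (x : R) : 0 <= x -> (x `^ (1/3)) ^+ 3 = x.
  move=> x0; rewrite -powR_mulrn ?powR_ge0// -powRrM.
  by rewrite (_ : 1 / 3 * 3%:R = 1) ?powRr1//; field.
have square (x : R) : x `^ (2/3) = (x `^ (1/3)) ^+ 2.
  by rewrite -powR_mulrn ?powR_ge0// -powRrM; congr (_ `^ _); field.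
(* Cube roots turn all fractional powers into monomials. *)
set x := (K%:R : R) `^ (1/3); set y := (T%:R : R) `^ (1/3); set z := V `^ (1/3).
have x0 : 0 < x by rewrite powR_gt0// ltr0n.
have y0 : 0 < y by rewrite powR_gt0// ltr0n.
have z0 : 0 < z by rewrite powR_gt0.
have xE : x ^+ 3 = K%:R by exact: cube.
have yE : y ^+ 3 = T%:R by exact: cube.
have zE : z ^+ 3 = V by exact: cube (ltW V0).
have -> : (8 + 2 * c1) * (K%:R * V) `^ (1 / 3) * T%:R `^ (2 / 3) =
    (8 + 2 * c1) * (x * z * y ^+ 2).
  by rewrite square powRM ?ler0n ?(ltW V0)// [RHS]mulrA.
(* The epoch length before rounding up. *)
set q := x * (y / z) ^+ 2.
have q0 : 0 < q by rewrite mulr_gt0// exprn_gt0// divr_gt0.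
set tau := epoch_length K T V.
have tau_int : (tau%:R : R) = (Num.ceil q)%:~R.
  have <- : (K%:R : R) `^ (1/3) * (T%:R / V) `^ (2/3) = q.
    rewrite square powRM ?ler0n ?invr_ge0 ?(ltW V0)// /q -/x -/y.
    by rewrite -[V^-1]powR_inv1 ?(ltW V0)// powRAC powR_inv1// powR_ge0.
  set e := _ * _; have e0 : 0 <= e by rewrite mulr_ge0 ?powR_ge0.
  have ce : 0 <= Num.ceil e by rewrite ceil_ge0; apply: lt_le_trans e0; rewrite ltrN10.
  by rewrite /tau /epoch_length -/e -[in RHS](gez0_abs ce).
have q_tau : q <= tau%:R by rewrite tau_int ceil_ge.
have tau_q : tau%:R < q + 1.
  by rewrite tau_int -ltrBlDr; have /andP[] := ceil_itv q; rewrite intrB.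
have tau0 : (0 < tau)%N by rewrite -(ltr0n R); exact: lt_le_trans q0 q_tau.
have tauT' : (tau%:R : R) <= T%:R by rewrite ler_nat.
(* [y <= x * z] means [T <= K * V]: the claimed rate is then at least [T] and the trivial bound
   suffices. Otherwise [K <= q <= tau], as the epoch bound requires. *)
have [TKV|KVT] := leP y (x * z).
  apply: le_trans (regret_le_trivial _ _ _ tau0 second_moment indep) _.
  rewrite lee_fin -yE exprS.
  have h : y * y ^+ 2 <= x * z * y ^+ 2 by rewrite ler_wpM2r// sqr_ge0.
  have xzy0 : 0 <= x * z * y ^+ 2 by rewrite !mulr_ge0// ?sqr_ge0// ltW.
  have := mulr_ge0 (ltW c10) xzy0.
  lra.
have x_yz : x <= y / z by rewrite ler_pdivlMr// ltW.
have Kq : K%:R <= q.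
  rewrite -xE /q exprS ler_pM2l// lerXn2r ?nnegrE// ltW// divr_gt0//.
have q1 : 1 <= q by apply: le_trans Kq; rewrite ler1n.
have Ktau : (K <= tau)%N by rewrite -(ler_nat R); exact: le_trans Kq q_tau.
apply: le_trans (regret_le_restarts _ a1 zeta0 psi_ge HK tau0 second_moment law indep
  Ktau TV) _.
rewrite lee_fin -/c1.
(* The balance behind the choice of [tau]: the drift term [q * V] is exactly the claimed rate. *)
have qV : q * V = x * z * y ^+ 2 by rewrite -zE /q; field; rewrite gt_eqF.
have first_term : 4 * tau%:R * V <= 8 * (x * z * y ^+ 2).
  rewrite -qV [leRHS](_ : _ = 4 * (2 * q) * V); last by ring.
  by rewrite ler_pM2r// ler_pM2l//; lra.
have tau0' : (0 : R) < tau%:R by rewrite ltr0n.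
(* The additional epoch is paid for by [tau <= T]. *)
have epochs : (T %/ tau).+1%:R <= 2 * T%:R / tau%:R :> R.
  rewrite ler_pdivlMr// -natr1 mulrDl mul1r -natrM.
  have : ((T %/ tau * tau)%N%:R : R) <= T%:R by rewrite ler_nat leq_trunc_div.
  by lra.
(* After squaring, this reads [T ^+ 2 * K / tau <= T ^+ 2 * K / q], which follows from
   [q <= tau]. *)
have root : T%:R / tau%:R * Num.sqrt (K%:R * tau%:R) <= x * z * y ^+ 2.
  have xzy0 : 0 <= x * z * y ^+ 2 by rewrite !mulr_ge0// ?sqr_ge0// ltW.
  rewrite -(@ler_pXn2r _ 2)// ?nnegrE ?mulr_ge0 ?invr_ge0 ?sqrtr_ge0//.
  rewrite exprMn sqr_sqrtr ?mulr_ge0//.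
  have -> : (x * z * y ^+ 2) ^+ 2 = T%:R ^+ 2 * K%:R / q.
    by rewrite -yE -xE /q; field; rewrite !gt_eqF.
  rewrite [leLHS](_ : _ = T%:R ^+ 2 * K%:R / tau%:R); last by field; rewrite gt_eqF.
  by apply: ler_wpM2l; [rewrite mulr_ge0 ?sqr_ge0|rewrite lef_pV2 ?posrE].
have second_term : (T %/ tau).+1%:R * (c1 * Num.sqrt (K%:R * tau%:R)) <=
    2 * c1 * (x * z * y ^+ 2).
  apply: le_trans (_ : 2 * T%:R / tau%:R * (c1 * Num.sqrt (K%:R * tau%:R)) <= _).
    by rewrite ler_wpM2r// mulr_ge0 ?sqrtr_ge0// ltW.
  rewrite [leLHS](_ : _ = 2 * c1 * (T%:R / tau%:R * Num.sqrt (K%:R * tau%:R)));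
    last by ring.
  by rewrite ler_pM2l// mulr_gt0.
lra.
Qed.
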